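(* Let $L$ be a finite simplicial graph and let $m$ be an integer with $m\ge 3$, or $m=2$ and the girth of $L$ at least $4$. A uniform lattice $\Gamma$ of $X=X(m,L)$ is commensurable to $W(m,L)$ in $\mathrm{Aut}(X)$ if and only if $\Gamma$ has a finite index subgroup preserving a system of local reflections whose holonomy is trivial.
   Context: Let $I$ be the vertex set of $L$. $W=W(m,L)$ is the Coxeter group $\langle s_i, i\in I\mid s_i^2=1\ (i\in I),\ (s_is_j)^m=1 \text{ for each edge }\{i,j\}\text{ of }L\rangle$. $X=X(m,L)$ is the (Davis) polygonal complex with vertex set $W$, one edge joining $w$ and $ws_i$ for each unordered pair $\{w,ws_i\}$, and one $2m$-gon glued along the $2m$-cycle with vertex set $w\langle s_i,s_j\rangle$ for each edge $\{i,j\}$ of $L$ and each coset. $W$ acts by left multiplication and is regarded as a subgroup of $\mathrm{Aut}(X)$, the group of combinatorial automorphisms of $X$. A uniform lattice is a subgroup of $\mathrm{Aut}(X)$ with finite vertex stabilizers and finitely many orbits of vertices. Subgroups $\Gamma_1,\Gamma_2$ of $G$ are commensurable in $G$ if for some $g\in G$ the group $g\Gamma_1g^{-1}\cap\Gamma_2$ has finite index in both. Let $A$ be the first barycentric subdivision of $X$; the rank of a vertex of $A$ is the dimension ($0,1,2$) of the cell of $X$ of which it is the center. $\mathrm{Aut}(X)$ is identified with the group of rank-preserving simplicial automorphisms of $A$. For a rank-0 vertex $x$ the block $B(x)$ is the closed star of $x$ in $A$. For a rank-1 vertex $v$, with adjacent rank-0 vertices $x,y$, put $U(v)=B(x)\cup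 B(y)$; the facet with center $v$ is $B(x)\cap B(y)$, i.e. the union of $v$ and of the edges of $A$ joining $v$ to rank-2 vertices. A local reflection at $v$ is a rank-preserving simplicial automorphism of $U(v)$ of order 2 that exchanges $x$ and $y$ and fixes the facet with center $v$ pointwise. A system of local reflections is a family $\sigma=(\sigma_v)_v$, $\sigma_v$ a local reflection at $v$, $v$ ranging over all rank-1 vertices. $\varphi\in\mathrm{Aut}(X)$ acts by $(\varphi_*\sigma)_v=\varphi\circ\sigma_{\varphi^{-1}(v)}\circ\varphi^{-1}$; a group preserves $\sigma$ if each of its elements fixes $\sigma$. For a triangle $\tau$ of $A$, contained in a polygon $\pi$ of $X$ and in the block $B(\tau)$, let $(a_1,\dots,a_{2m})$ be the combinatorial edge-path winding once around $\partial\pi$, starting at the rank-0 vertex of $\tau$ and such that the subdivision of $a_1$ contains an edge of $\tau$, and let $v_j$ be the center of $a_j$; the holonomy of $\sigma$ at $\tau$ is the automorphism $h_\sigma(\tau)=\sigma_{v_{2m}}\circ\dots\circ\sigma_{v_1}$ of $B(\tau)$. $\sigma$ has trivial holonomy (no holonomy) if $h_\sigma(\tau)=1$ for every triangle $\tau$. *)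

(* Defs.v *)
From HB Require Import structures.
From mathcomp Require Import all_boot.
From mathcomp Require Import generic_quotient monoid.
From mathcomp Require Import boolp classical_sets functions cardinality.

Set Implicit Arguments.
Unset Strict Implicit.
Unset Printing Implicit Defensive.

Import Algebra.
Local Open Scope quotient_scope.
Local Open Scope classical_set_scope.
Local Open Scope group_scope.

Section Subgroups.
Variable G : groupType.
Implicit Types (H K : set G) (g : G).

Definition subgroup H : Prop :=
  H 1 /\ forall x y, H x -> H y -> H (x * y^-1).

Definition lcoset_set g H : set G := [set g * h | h in H].

Definition conj_set g H : set G := [set g * h * g^-1 | h in H].

Definition generated (S : set G) : set G :=
  [set g | forall H, subgroup H -> S `<=` H -> H g].

Definition finite_index H K : Prop :=
  H `<=` K /\ finite_set [set lcoset_set k H | k in K].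

Definition commensurable H K : Prop :=
  exists g, finite_index (conj_set g H `&` K) (conj_set g H)
         /\ finite_index (conj_set g H `&` K) K.

End Subgroups.

(* [girth_ge e n]: every cycle of the graph has length at least [n]; an acyclic
   graph has infinite girth. *)
Definition girth_ge (I : finType) (e : rel I) (n : nat) : Prop :=
  forall c : seq I, (3 <= size c)%N -> ucycle e c -> (n <= size c)%N.

(* The Coxeter group W(m,L), L being the graph with vertex type [I] and
   adjacency relation [e]. As every generator is an involution, the group
   presentation is also a monoid presentation: elements are words in the
   generators modulo the congruence generated by the relators. *)

Section CoxeterGroup.
Variables (I : finType) (e : rel I) (m : nat).

Inductive cox_eq : seq I -> seq I -> Prop :=
| cox_refl u : cox_eq u u
| cox_sym u v : cox_eq u v -> cox_eq v u
| cox_trans u v w : cox_eq u v -> cox_eq v w -> cox_eq u w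
| cox_square u v i : cox_eq (u ++ [:: i; i] ++ v) (u ++ v)
| cox_edge u v i j : e i j ->
    cox_eq (u ++ flatten (nseq m [:: i; j]) ++ v) (u ++ v).

Definition cox_rel : rel (seq I) := fun u v => `[< cox_eq u v >].

Lemma cox_rel_equiv : equiv_class_of cox_rel.
Proof.
split=> [u|u v|v u w].
- by apply/asboolP; exact: cox_refl.
- by apply/asboolP/asboolP; exact: cox_sym.
- by move=> /asboolP uv /asboolP vw; apply/asboolP; exact: cox_trans uv vw.
Qed.

Canonical cox_equiv := EquivRelPack cox_rel_equiv.

Definition coxeter := {eq_quot cox_equiv}.
HB.instance Definition _ := Choice.on coxeter.
HB.instance Definition _ := EqQuotient.on coxeter.

Definition cox_word (u : seq I) : coxeter := \pi_coxeter u.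

Lemma cox_wordP u v : cox_word u = cox_word v <-> cox_eq u v.
Proof.
split=> [/eqmodP|uv]; first by move=> /= /asboolP.
by apply/eqmodP/asboolP.
Qed.

Lemma cox_eq_cat u u' v v' :
  cox_eq u u' -> cox_eq v v' -> cox_eq (u ++ v) (u' ++ v').
Proof.
have catl w a b : cox_eq a b -> cox_eq (w ++ a) (w ++ b).
  elim=> *; [exact: cox_refl|exact: cox_sym|by apply: cox_trans; eassumption| |].
  - by rewrite !catA -(catA (w ++ _)); exact: cox_square.
  - by rewrite !catA -(catA (w ++ _)); exact: cox_edge.
have catr w a b : cox_eq a b -> cox_eq (a ++ w) (b ++ w).
  elim=> *; [exact: cox_refl|exact: cox_sym|by apply: cox_trans; eassumption| |].
  - by rewrite -!catA; exact: cox_square.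
  - by rewrite -!catA; exact: cox_edge.
by move=> uu' vv'; apply: cox_trans (catr _ _ _ uu') (catl _ _ _ vv').
Qed.

Lemma cox_eq_catrev u : cox_eq (rev u ++ u) [::].
Proof.
elim: u => [|i u IH]; first exact: cox_refl.
rewrite rev_cons -cats1 -catA.
exact: cox_trans (cox_square _ _ i) IH.
Qed.

Definition cox_one : coxeter := cox_word [::].
Definition cox_mul (x y : coxeter) : coxeter := cox_word (repr x ++ repr y).
Definition cox_inv (x : coxeter) : coxeter := cox_word (rev (repr x)).

Lemma cox_repr u : cox_eq (repr (cox_word u)) u.
Proof. by apply/cox_wordP; rewrite /cox_word reprK. Qed.

Lemma cox_reprK x : cox_word (repr x) = x.
Proof. exact: reprK. Qed.

Lemma cox_mul_word u v : cox_mul (cox_word u) (cox_word v) = cox_word (u ++ v).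
Proof. by apply/cox_wordP; apply: cox_eq_cat; exact: cox_repr. Qed.

Lemma cox_mulA : associative cox_mul.
Proof.
move=> x y z; rewrite -(cox_reprK x) -(cox_reprK y) -(cox_reprK z).
by rewrite !cox_mul_word catA.
Qed.

Lemma cox_mul1 : left_id cox_one cox_mul.
Proof. by move=> x; rewrite -(cox_reprK x) cox_mul_word. Qed.

Lemma cox_mulr1 : right_id cox_one cox_mul.
Proof. by move=> x; rewrite -(cox_reprK x) cox_mul_word cats0. Qed.

Lemma cox_mulV : left_inverse cox_one cox_inv cox_mul.
Proof.
move=> x; rewrite -{2}(cox_reprK x) cox_mul_word.
by apply/cox_wordP; exact: cox_eq_catrev.
Qed.

Lemma cox_mulrV : right_inverse cox_one cox_inv cox_mul.
Proof.
move=> x; rewrite -{1}(cox_reprK x) cox_mul_word.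
by apply/cox_wordP; rewrite -{1}(revK (repr x)); exact: cox_eq_catrev.
Qed.

HB.instance Definition _ :=
  isGroup.Build coxeter cox_mulA cox_mul1 cox_mulr1 cox_mulV cox_mulrV.

Definition cox_gen (i : I) : coxeter := cox_word [:: i].

End CoxeterGroup.

Section DavisComplex.
Variables (I : finType) (e : rel I) (m : nat).
Local Notation W := (coxeter e m).
Local Notation s := (@cox_gen I e m).

Definition is_edge (E : set W) : Prop :=
  exists w i, E = [set w; w * s i].

Definition is_polygon (P : {set I} * set W) : Prop :=
  exists i j w, [/\ e i j, P.1 = [set i; j]%SET &
    P.2 = lcoset_set w (generated [set s i; s j])].

(* The cells of X, i.e. the vertices of its barycentric subdivision A: elements
   w of W, edges {w, w s_i}, and one polygon for each edge {i,j} of L and each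
   left coset of <s_i, s_j>. *)
Inductive cell : Type :=
| Vertex of W
| Edge of {E : set W | is_edge E}
| Polygon of {P : {set I} * set W | is_polygon P}.

HB.instance Definition _ := gen_eqMixin cell.

Definition rank (c : cell) : nat :=
  match c with Vertex _ => 0 | Edge _ => 1 | Polygon _ => 2 end.

(* [face c d]: the closed cell d contains the cell c. The boundary of a polygon
   of type {i,j} is made of the edges {u, u s_k} with u in its coset and
   k = i or k = j. *)
Definition face (c d : cell) : Prop :=
  match c, d with
  | Vertex w, Edge E => sval E w
  | Vertex w, Polygon P => (sval P).2 w
  | Edge E, Polygon P =>
      exists u k, [/\ (sval P).2 u, k \in (sval P).1 & sval E = [set u; u * s k]]
  | Vertex _, Vertex _ | Edge _, Edge _ | Polygon _, Polygon _ => c = d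
  | _, _ => False
  end.

(* The simplices of A, as nonempty chains of cells. Below, a subcomplex of A is
   a set of simplices. *)
Definition simplex (S : set cell) : Prop :=
  S !=set0 /\ forall c d, S c -> S d -> face c d \/ face d c.

Definition vertices (K : set (set cell)) : set cell := [set c | K [set c]].

(* Only the restriction of [f] to the vertices of [K] is relevant. *)
Definition rank_automorphism (K : set (set cell)) (f : cell -> cell) : Prop :=
  [/\ set_bij (vertices K) (vertices K) f,
      forall c, vertices K c -> rank (f c) = rank c &
      forall S, S `<=` vertices K -> (K (f @` S) <-> K S)].

Record autX := AutX {
  aut_fun :> cell -> cell;
  aut_inv : cell -> cell;
  aut_funK : cancel aut_fun aut_inv;
  aut_invK : cancel aut_inv aut_fun;
  aut_rank : forall c, rank (aut_fun c) = rank c;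
  aut_simplex : forall S, simplex (aut_fun @` S) <-> simplex S
}.

HB.instance Definition _ := gen_eqMixin autX.
HB.instance Definition _ := gen_choiceMixin autX.

Lemma autX_eq (f g : autX) : aut_fun f =1 aut_fun g -> f = g.
Proof.
case: f g => f f' fK f'K rf sf [g g' gK g'K rg sg] /= /funext fg.
case: _ / fg g' gK g'K rg sg => g' gK g'K rg sg.
have g'f' : g' = f' by apply/funext => c; rewrite -{1}(f'K c) gK.
case: _ / (esym g'f') gK g'K => gK g'K.
by congr AutX; exact: Prop_irrelevance.
Qed.

Definition autX_one : autX.
Proof. by exists idfun idfun => // S; rewrite image_id. Defined.

Definition autX_mul (f g : autX) : autX.
Proof.
exists (aut_fun f \o aut_fun g) (aut_inv g \o aut_inv f).
- by move=> c /=; rewrite !aut_funK.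
- by move=> c /=; rewrite !aut_invK.
- by move=> c /=; rewrite !aut_rank.
- by move=> S; rewrite -image_comp !aut_simplex.
Defined.

Definition autX_inv (f : autX) : autX.
Proof.
exists (aut_inv f) (aut_fun f).
- exact: aut_invK.
- exact: aut_funK.
- by move=> c; rewrite -[RHS](congr1 rank (aut_invK f c)) aut_rank.
- move=> S; rewrite -(aut_simplex f) image_comp.
  by rewrite (_ : aut_fun f \o aut_inv f = id) ?image_id//; apply/funext/aut_invK.
Defined.

Lemma autX_mulA : associative autX_mul. Proof. by move=> f g h; exact: autX_eq. Qed.
Lemma autX_mul1 : left_id autX_one autX_mul. Proof. by move=> f; exact: autX_eq. Qed.
Lemma autX_mulr1 : right_id autX_one autX_mul. Proof. by move=> f; exact: autX_eq. Qed.
Lemma autX_mulV : left_inverse autX_one autX_inv autX_mul.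
Proof. by move=> f; apply: autX_eq => c; exact: aut_funK. Qed.
Lemma autX_mulrV : right_inverse autX_one autX_inv autX_mul.
Proof. by move=> f; apply: autX_eq => c; exact: aut_invK. Qed.

HB.instance Definition _ :=
  isGroup.Build autX autX_mulA autX_mul1 autX_mulr1 autX_mulV autX_mulrV.

Lemma lcoset_edge w E : is_edge E -> is_edge (lcoset_set w E).
Proof.
move=> [u [i ->]]; exists (w * u), i.
by rewrite /lcoset_set image_setU !image_set1 mulgA.
Qed.

Lemma lcoset_lcoset w u (S : set W) :
  lcoset_set w (lcoset_set u S) = lcoset_set (w * u) S.
Proof.
rewrite /lcoset_set image_comp; congr image.
by apply/funext => x /=; rewrite mulgA.
Qed.

Lemma lcoset_polygon w P :
  is_polygon P -> is_polygon (P.1, lcoset_set w P.2).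
Proof.
move=> [i [j [u [eij P1 P2]]]]; exists i, j, (w * u); split => //=.
by rewrite P2 lcoset_lcoset.
Qed.

Definition lmul_cell (w : W) (c : cell) : cell :=
  match c with
  | Vertex u => Vertex (w * u)
  | Edge (exist E HE) => Edge (exist _ _ (lcoset_edge w HE))
  | Polygon (exist P HP) => Polygon (exist _ _ (lcoset_polygon w HP))
  end.

Lemma lcoset1 (S : set W) : lcoset_set 1 S = S.
Proof.
rewrite /lcoset_set (_ : *%g 1 = id) ?image_id//.
by apply/funext => x; rewrite mul1g.
Qed.

Lemma lmul_cellM w u c : lmul_cell w (lmul_cell u c) = lmul_cell (w * u) c.
Proof.
case: c => [x|[E HE]|[P HP]] /=; first by rewrite mulgA.
- by congr Edge; apply: eq_exist; exact: lcoset_lcoset.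
- by congr Polygon; apply: eq_exist; rewrite /= lcoset_lcoset.
Qed.

Lemma lmul_cell1 c : lmul_cell 1 c = c.
Proof.
case: c => [x|[E HE]|[[T C] HP]] /=; first by rewrite mul1g.
- by congr Edge; apply: eq_exist; exact: lcoset1.
- by congr Polygon; apply: eq_exist; rewrite /= lcoset1.
Qed.

Lemma lmul_face w c d : face c d -> face (lmul_cell w c) (lmul_cell w d).
Proof.
case: c => [x|[E HE]|[P HP]]; case: d => [y|[F HF]|[Q HQ]] //=.
- by move=> [->].
- by move=> Fx; exists x.
- by move=> Qx; exists x.
- by move=> [EF]; congr Edge; apply: eq_exist; rewrite EF.
- move=> [u [k [Qu kQ ->]]]; exists (w * u), k; split => //; first by exists u.
  by rewrite /lcoset_set image_setU !image_set1 mulgA.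
- by move=> [PQ]; congr Polygon; apply: eq_exist; rewrite PQ.
Qed.

Lemma lmul_simplex w S : simplex S -> simplex (lmul_cell w @` S).
Proof.
move=> [[c Sc] S_chain]; split; first by exists (lmul_cell w c), c.
move=> _ _ [a Sa <-] [b Sb <-].
by have [ab|ba] := S_chain _ _ Sa Sb; [left|right]; exact: lmul_face.
Qed.

Definition lmul (w : W) : autX.
Proof.
exists (lmul_cell w) (lmul_cell w^-1).
- by move=> c; rewrite lmul_cellM mulVg lmul_cell1.
- by move=> c; rewrite lmul_cellM mulgV lmul_cell1.
- by case=> [x|[E HE]|[P HP]].
- move=> S; split; last exact: lmul_simplex.
  move=> /(lmul_simplex w^-1); rewrite image_comp.
  rewrite (_ : _ \o _ = id) ?image_id//.
  by apply/funext => c /=; rewrite lmul_cellM mulVg lmul_cell1.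
Defined.

Definition W_in_autX : set autX := range lmul.

Definition uniform_lattice (Gamma : set autX) : Prop :=
  [/\ subgroup Gamma,
      forall w, finite_set [set g | Gamma g /\ g (Vertex w) = Vertex w] &
      finite_set [set [set g (Vertex w) | g in Gamma] | w in [set: W]]].

(* The closed star of [x] in A. *)
Definition block (x : cell) : set (set cell) :=
  [set S | S !=set0 /\ simplex (x |` S)].

Definition ends (v : cell) : set cell := [set x | rank x = 0%N /\ face x v].

Definition block_union (v : cell) : set (set cell) :=
  \bigcup_(x in ends v) block x.

Definition facet (v : cell) : set (set cell) :=
  \bigcap_(x in ends v) block x.

Definition local_reflection (v : cell) (f : cell -> cell) : Prop :=
  [/\ rank_automorphism (block_union v) f,
      forall c, vertices (block_union v) c -> f (f c) = c,
      forall x y, ends v x -> ends v y -> x <> y -> f x = y &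
      forall c, vertices (facet v) c -> f c = c].

(* A system of local reflections is a family indexed by the cells of rank 1;
   [sigma v] is irrelevant if [v] has another rank, and so are the values of
   [sigma v] outside U(v). *)
Definition local_reflection_system (sigma : cell -> cell -> cell) : Prop :=
  forall v, rank v = 1%N -> local_reflection v (sigma v).

Definition pushforward (phi : autX) (sigma : cell -> cell -> cell)
    : cell -> cell -> cell :=
  fun v => phi \o sigma ((phi^-1)%g v) \o (phi^-1)%g.

Definition preserves (Gamma : set autX) (sigma : cell -> cell -> cell) : Prop :=
  forall phi, Gamma phi -> forall v, rank v = 1%N ->
    forall c, vertices (block_union v) c -> pushforward phi sigma v c = sigma v c.

(* [edge_path x a y]: the sequence of edges [a] is a combinatorial edge-path
   from [x] to [y]. *)
Fixpoint edge_path (x : cell) (a : seq cell) (y : cell) : Prop :=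
  match a with
  | [::] => x = y
  | v :: a' => exists z,
      [/\ rank v = 1%N, ends v = [set x; z], x <> z & edge_path z a' y]
  end.

(* [a] goes around the boundary of the 2m-gon [p] once, starting at [x]: it is
   a closed path that uses each of the 2m edges of [p] exactly once. *)
Definition winds_once (p x : cell) (a : seq cell) : Prop :=
  [/\ edge_path x a x, forall v, v \in a -> face v p, uniq a &
      size a = (2 * m)%N].

Definition triangle (x v p : cell) : Prop :=
  [/\ rank x = 0%N, rank v = 1%N, rank p = 2%N & simplex [set x; v; p]].

(* For [a] = (v_1, ..., v_2m), the composite of sigma_(v_2m), ..., sigma_(v_1),
   in which sigma_(v_1) is applied first. *)
Definition holonomy (sigma : cell -> cell -> cell) (a : seq cell) (c : cell) :=
  foldl (fun d v => sigma v d) c a.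

Definition trivial_holonomy (sigma : cell -> cell -> cell) : Prop :=
  forall x v p a, triangle x v p -> winds_once p x (v :: a) ->
    forall c, vertices (block x) c -> holonomy sigma (v :: a) c = c.

End DavisComplex.

(* Main.v *)
(* The star of a vertex of A is determined by the types (in I, resp. in the
   edges of L) of its cells, so a system of local reflections sigma amounts to a
   family con(w, i) of automorphisms of L, one for each oriented edge (w, w s_i):
   sigma sends the edge (w, w s_k) to (w s_i, w s_i s_(con(w, i) k)).  Fixing the
   facet makes con(w, i) fix i and its neighbours, and trivial holonomy makes the
   connection con flat.  Parallel transport from the vertex 1 then gives new types
   to the edges at each vertex, and reading the words of W along these types is an
   automorphism phi of X that carries the standard system of reflections to sigma.
   If Gamma' preserves sigma, an element of phi^-1 Gamma' phi changes the types by
   a permutation of I that is the same at all vertices, and it is in W when this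
   permutation is trivial; this is a condition of finite index.  Cocompactness
   gives finite index in W.

   Conversely, pull back by g the system of the reflections in W: its composite
   along a path from x to y is the element of g^-1 W g that sends x to y, hence
   the identity if the path is closed. *)

From mathcomp Require Import all_boot fingroup perm.
From mathcomp Require Import generic_quotient monoid.
From mathcomp Require Import boolp classical_sets functions cardinality.
Require Import Defs.

Set Implicit Arguments.
Unset Strict Implicit.
Unset Printing Implicit Defensive.

Import Algebra.
Local Open Scope classical_set_scope.
Local Open Scope group_scope.

(** * Finite index subgroups *)

Section GroupSets.
Variable G : groupType.
Implicit Types (H K : set G) (g k : G).

Lemma subgroupM H x y : subgroup H -> H x -> H y -> H (x * y).
Proof.
move=> [H1 HV] Hx Hy; rewrite -(invgK y); apply: (HV) => //.
by rewrite -(mul1g y^-1); exact: HV.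
Qed.

Lemma subgroupV H x : subgroup H -> H x -> H x^-1.
Proof. by move=> [H1 HV] Hx; rewrite -(mul1g x^-1); exact: HV. Qed.

Lemma generated_subgroup (S : set G) : subgroup (generated S).
Proof.
split=> [H [] //|x y Sx Sy H sH SH].
by apply: sH.2; [exact: Sx|exact: Sy].
Qed.

Lemma sub_generated (S : set G) : S `<=` generated S.
Proof. by move=> x Sx H _; exact. Qed.

Lemma lcoset_setP g k H : lcoset_set g H k <-> H (g^-1 * k).
Proof.
split=> [[h Hh <-]|Hgk]; first by rewrite mulKg.
by exists (g^-1 * k) => //; rewrite mulVKg.
Qed.

Lemma lcoset_set_eq g k H : subgroup H ->
  lcoset_set g H = lcoset_set k H <-> H (g^-1 * k).
Proof.
move=> sH; split=> [gkH|Hgk].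
  by apply/lcoset_setP; rewrite gkH; apply/lcoset_setP; rewrite mulVg; exact: sH.1.
apply/seteqP; split=> x /lcoset_setP Hx; apply/lcoset_setP.
- rewrite -(mulVKg g x) mulgA; apply: subgroupM => //.
  by rewrite -[_ * _]invgK invgM invgK; exact: subgroupV.
- by rewrite -(mulVKg k x) mulgA; exact: subgroupM.
Qed.

Lemma conj_setP g k H : conj_set g H k <-> H (g^-1 * k * g).
Proof.
split=> [[h Hh <-]|Hgk]; first by rewrite -!mulgA mulVg mulg1 mulKg.
by exists (g^-1 * k * g) => //; rewrite -!mulgA mulgV mulg1 mulVKg.
Qed.

Lemma conj_setK g H : conj_set g^-1 (conj_set g H) = H.
Proof.
apply/seteqP; split=> x.
  by move=> /conj_setP/conj_setP; rewrite invgK -!mulgA mulVg mulg1 mulKg.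
move=> Hx; apply/conj_setP/conj_setP.
by rewrite invgK -!mulgA mulVg mulg1 mulKg.
Qed.

Lemma conj_set_subgroup g H : subgroup H -> subgroup (conj_set g H).
Proof.
move=> sH; split=> [|x y /conj_setP Hx /conj_setP Hy]; apply/conj_setP.
  by rewrite mulg1 mulVg; exact: sH.1.
have -> : g^-1 * (x * y^-1) * g = g^-1 * x * g * (g^-1 * y * g)^-1.
  by rewrite !invgM invgK -!mulgA mulVKg.
exact: sH.2.
Qed.

(** Elements of K with equal [c] lie in one left coset of H, so choosing an element in each fibre
    maps the finite set of values onto the cosets. The default 1 of [xget] occurs only off that
    set. *)
Lemma finite_index_separate (T : Type) (c : G -> T) H K :
  subgroup H -> H `<=` K -> finite_set (c @` K) ->
  (forall k1 k2, K k1 -> K k2 -> c k1 = c k2 -> H (k1^-1 * k2)) ->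
  finite_index H K.
Proof.
move=> sH HK finc cH; split=> //.
pose r t := lcoset_set (xget 1 [set k | K k /\ c k = t]) H.
apply: (sub_finite_set _ (finite_image r finc)) => _ [k Kk <-].
exists (c k); first by exists k.
rewrite /r; case: xgetP => [x _ [Kx cx]|/(_ k)]; last by case.
by apply/lcoset_set_eq => //; exact: cH.
Qed.

(** A coset of N in K is pinned down by the coset of H together with the value of [d] on the H-part
    of the element, taken relative to a fixed representative of that coset; the representatives
    cancel in the quotient. *)
Lemma finite_index_refine (F : finType) (d : G -> F) H N K :
  subgroup H -> subgroup N -> N `<=` K -> finite_index H K ->
  (forall a b, H a -> H b -> d a = d b -> N (a^-1 * b)) -> finite_index N K.
Proof.
move=> sH sN NK [HK finH] dN.
pose r (C : set G) := xget 1 [set k | lcoset_set k H = C].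
have rP k : lcoset_set (r (lcoset_set k H)) H = lcoset_set k H.
  by rewrite /r; case: xgetP => [x _ //|/(_ k) []].
pose q k := r (lcoset_set k H).
have Hq k : H ((q k)^-1 * k) by apply/lcoset_set_eq => //; exact: rP.
pose c k := (lcoset_set k H, d ((q k)^-1 * k)).
apply: (@finite_index_separate _ c) => //.
  apply: (sub_finite_set _ (finite_setX finH (@finite_finset _ [set: F]))).
  by move=> _ [k Kk <-]; split=> //=; exists k.
move=> k1 k2 Kk1 Kk2 [eqH eqd].
have q12 : q k1 = q k2 by rewrite /q eqH.
have := dN _ _ (Hq k1) (Hq k2) eqd.
by rewrite q12 invgM invgK -mulgA mulVKg.
Qed.

Lemma finite_index_conj g H K :
  finite_index H K -> finite_index (conj_set g H) (conj_set g K).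
Proof.
move=> [HK finH]; split=> [x /conj_setP Hx|]; first by apply/conj_setP; exact: HK.
apply: (sub_finite_set _ (finite_image (conj_set g) finH)).
move=> _ [_ [k Kk <-] <-]; exists (lcoset_set k H); first by exists k.
apply/seteqP; split=> x.
  move=> /conj_setP/lcoset_setP Hx; apply/lcoset_setP/conj_setP.
  by move: Hx; rewrite !invgM invgK -!mulgA mulKg.
move=> /lcoset_setP/conj_setP Hx; apply/conj_setP/lcoset_setP.
by move: Hx; rewrite !invgM invgK -!mulgA mulKg.
Qed.

End GroupSets.

(** * Actions of the Coxeter group *)

Section CoxeterAction.
Variables (I : finType) (e : rel I) (m : nat).
Local Notation W := (coxeter e m).
Local Notation s := (@cox_gen I e m).
Local Notation cox_word := (@cox_word I e m).

Lemma cox_wordM u v : cox_word u * cox_word v = cox_word (u ++ v).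
Proof. exact: cox_mul_word. Qed.

Lemma cox_word_cons i u : cox_word (i :: u) = s i * cox_word u.
Proof. by rewrite cox_wordM. Qed.

Lemma cox_gen2 i : s i * s i = 1.
Proof. by rewrite cox_wordM; apply/cox_wordP; exact: (cox_square _ _ [::] [::]). Qed.

Lemma cox_genK w i : w * s i * s i = w.
Proof. by rewrite -mulgA cox_gen2 mulg1. Qed.

Lemma cox_gen_pow i j : e i j -> cox_word (flatten (nseq m [:: i; j])) = 1.
Proof.
move=> eij; apply/cox_wordP.
by have := cox_edge m [::] [::] eij; rewrite cats0.
Qed.

Lemma cox_ind (P : W -> Prop) :
  P 1 -> (forall w i, P w -> P (w * s i)) -> forall w, P w.
Proof.
move=> P1 PS w; rewrite -(cox_reprK w).
elim/last_ind: (repr w) => [//|u i IH].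
by rewrite -cats1 -cox_wordM; exact: PS.
Qed.

Section Action.
Variables (S : Type) (step : S -> I -> S).

Lemma foldl_alternate x i j n :
  foldl step x (flatten (nseq n [:: i; j])) =
  iter n (fun y => step (step y i) j) x.
Proof. by elim: n x => //= n IH x; rewrite IH -iterSr. Qed.

Hypothesis step2 : forall x i, step (step x i) i = x.
Hypothesis step_edge : forall x i j, e i j ->
  iter m (fun y => step (step y i) j) x = x.

Lemma foldl_cox_eq u v : cox_eq e m u v -> forall x, foldl step x u = foldl step x v.
Proof.
elim=> {u v} //= [u v w _ IH1 _ IH2 x|u v i x|u v i j eij x].
- by rewrite IH1.
- by rewrite !foldl_cat /= step2.
- by rewrite !foldl_cat foldl_alternate step_edge.
Qed.

(** The right action of W extending [step]; by [foldl_cox_eq] every word for w gives the same value.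
    The state may carry more than a vertex: this is how data accumulated along a path are shown to
    depend only on its ends. *)
Definition cox_act (x : S) (w : W) : S := foldl step x (repr w).

Lemma cox_act_word x u : cox_act x (cox_word u) = foldl step x u.
Proof. by apply: foldl_cox_eq; exact: cox_repr. Qed.

Lemma cox_act1 x : cox_act x 1 = x.
Proof. exact: (cox_act_word x [::]). Qed.

Lemma cox_actM x w i : cox_act x (w * s i) = step (cox_act x w) i.
Proof.
rewrite -(cox_reprK w) cox_wordM !cox_act_word.
by rewrite foldl_cat.
Qed.

End Action.

End CoxeterAction.

(* Words act on the 2m-cycle with vertices [bool * 'I_m]: [i] acts by the
   reflection exchanging (false, k) and (true, k), and every other generator by
   the one exchanging (true, k) and (false, k + 1). *)
Section Dihedral.
Variables (I : finType) (e : rel I) (m : nat).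
Hypothesis (e_irr : irreflexive e) (m_gt1 : (1 < m)%N).
Local Notation W := (coxeter e m).
Local Notation s := (@cox_gen I e m).

Definition dih_step (i : I) (z : bool * 'I_m) (k : I) : bool * 'I_m :=
  if k == i then (~~ z.1, z.2)
  else if z.1 then (false, ordS z.2) else (true, ord_pred z.2).

Lemma dih_step2 i z k : dih_step i (dih_step i z k) k = z.
Proof.
rewrite /dih_step; case: eqP => _; first by rewrite negbK; case: z.
by case: z => [[] x] /=; rewrite ?ordSK ?ord_predK.
Qed.

Lemma iter_ordS (x : 'I_m) : iter m (@ordS m) x = x.
Proof.
apply: val_inj.
have -> n : val (iter n (@ordS m) x) = (x + n) %% m :> nat.
  elim: n => [|n /= ->]; first by rewrite addn0 modn_small.
  by rewrite -addn1 modnDml addn1 addnS.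
by rewrite modnDr modn_small.
Qed.

Lemma iter_ord_pred (x : 'I_m) : iter m (@ord_pred m) x = x.
Proof.
have itK n y : iter n (@ord_pred m) (iter n (@ordS m) y) = y.
  by elim: n => // n IH; rewrite iterSr iterS ordSK.
by rewrite -{1}(iter_ordS x) itK.
Qed.

(** If exactly one of k and l is i, the two reflections compose to a shift of the second coordinate
    by one, its direction depending on [z.1] and on which of the two is i; the m-th power of a shift
    is trivial. If neither is i, the same reflection is applied twice. *)
Lemma dih_step_edge i z k l : e k l ->
  iter m (fun y => dih_step i (dih_step i y k) l) z = z.
Proof.
move=> ekl; have kl : k != l by apply/eqP => kl; rewrite kl e_irr in ekl.
pose A n : bool * 'I_m := (z.1, iter n (@ordS m) z.2).
pose B n : bool * 'I_m := (z.1, iter n (@ord_pred m) z.2).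
have zA : A m = z by rewrite /A iter_ordS; case: (z).
have zB : B m = z by rewrite /B iter_ord_pred; case: (z).
pose P y := dih_step i (dih_step i y k) l; rewrite -/P.
have [ki|ki] := eqVneq k i; have [li|li] := eqVneq l i.
- by rewrite ki li eqxx in kl.
- case z1 : z.1.
  + suff itP n : iter n P z = B n by rewrite itP.
    elim: n => [|n /= ->]; first by rewrite /B; case: (z).
    by rewrite /P /dih_step ki eqxx (negbTE li) /A /B /= z1 /=.
  + suff itP n : iter n P z = A n by rewrite itP.
    elim: n => [|n /= ->]; first by rewrite /A; case: (z).
    by rewrite /P /dih_step ki eqxx (negbTE li) /A /B /= z1 /=.
- case z1 : z.1.
  + suff itP n : iter n P z = A n by rewrite itP.
    elim: n => [|n /= ->]; first by rewrite /A; case: (z).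
    by rewrite /P /dih_step li eqxx (negbTE ki) /A /B /= z1 /=.
  + suff itP n : iter n P z = B n by rewrite itP.
    elim: n => [|n /= ->]; first by rewrite /B; case: (z).
    by rewrite /P /dih_step li eqxx (negbTE ki) /A /B /= z1 /=.
- suff itP n : iter n P z = z by rewrite itP.
  elim: n => //= n ->.
  rewrite /P /dih_step (negbTE ki) (negbTE li).
  by case: (z) => [[] x] /=; rewrite ?ordSK ?ord_predK.
Qed.

Definition dih_act i (w : W) :=
  cox_act (dih_step i) (false, Ordinal (ltnW m_gt1)) w.

Lemma dih_actM i w k : dih_act i (w * s k) = dih_step i (dih_act i w) k.
Proof. by apply: cox_actM; [exact: dih_step2|exact: dih_step_edge]. Qed.

Lemma dih_act1 i : dih_act i 1 = (false, Ordinal (ltnW m_gt1)).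
Proof. by apply: cox_act1; [exact: dih_step2|exact: dih_step_edge]. Qed.

Lemma cox_gen_neq1 i : s i <> 1.
Proof.
move=> /(congr1 (dih_act i)).
by rewrite -[s i]mul1g dih_actM dih_act1 /dih_step eqxx.
Qed.

(** On the 2m-cycle, s_i moves the base vertex (false, 0) to (true, 0), while any other generator
    moves it to (true, m - 1); these differ because m > 1. *)
Lemma cox_gen_inj : injective s.
Proof.
move=> i k /(congr1 (dih_act i)); rewrite -[s i]mul1g -[s k]mul1g !dih_actM dih_act1.
rewrite /dih_step eqxx; have [->//|_] := eqVneq k i.
move=> /(congr1 (fun z : bool * 'I_m => val z.2)) /= /esym /eqP.
rewrite add0n modn_small; last by rewrite prednK ?leqnn // ltnW.
by case: (m) m_gt1 => [|[]].
Qed.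

End Dihedral.

(** * Cells of the Davis complex *)

Section Cells.
Variables (I : finType) (e : rel I) (m : nat).
Hypotheses (e_sym : symmetric e) (e_irr : irreflexive e) (m_gt1 : (1 < m)%N).
Local Notation W := (coxeter e m).
Local Notation s := (@cox_gen I e m).
Local Notation cell := (cell e m).
Implicit Types (c d : cell) (w : W) (i j k : I).

Lemma is_edge_std w i : is_edge [set w; w * s i].
Proof. by exists w, i. Qed.

Definition edg w i : cell := Edge (exist _ _ (is_edge_std w i)).

Local Notation dih i j := (generated [set s i; s j]).

Lemma is_polygon_std w i j :
  e i j -> is_polygon ([set i; j]%SET, lcoset_set w (dih i j)).
Proof. by move=> eij; exists i, j, w. Qed.

(* Junk value [Vertex w] when {i, j} is not an edge of L. *)
Definition pol w i j : cell :=
  if pselect (e i j) is left eij then Polygon (exist _ _ (is_polygon_std w eij))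
  else Vertex w.

Lemma polE w i j (eij : e i j) :
  pol w i j = Polygon (exist _ _ (is_polygon_std w eij)).
Proof. by rewrite /pol; case: pselect => // h; congr Polygon; exact: eq_exist. Qed.

Variant cell_spec : cell -> Prop :=
| CellVertex w : cell_spec (Vertex w)
| CellEdge w i : cell_spec (edg w i)
| CellPolygon w i j of e i j : cell_spec (pol w i j).

Lemma cellP c : cell_spec c.
Proof.
case: c => [w|[E HE]|[[T C] HP]]; first exact: CellVertex.
- have [w [i Ewi]] := HE.
  suff -> : Edge (exist _ E HE) = edg w i by exact: CellEdge.
  by congr Edge; exact: eq_exist.
- have [i [j [w [eij /= T_ij C_ij]]]] := HP.
  suff -> : Polygon (exist _ (T, C) HP) = pol w i j by exact: CellPolygon.
  by rewrite (polE w eij); congr Polygon; apply: eq_exist; rewrite /= T_ij C_ij.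
Qed.

Lemma rank_pol w i j : e i j -> rank (pol w i j) = 2.
Proof. by move=> eij; rewrite (polE w eij). Qed.

Lemma edg_flip w i : edg (w * s i) i = edg w i.
Proof.
by congr Edge; apply: eq_exist => /=; rewrite cox_genK setUC.
Qed.

Lemma edg_inj w i w' i' : edg w i = edg w' i' -> i = i' /\ (w' = w \/ w' = w * s i).
Proof.
move=> [/= Eww'].
have s1 k := @cox_gen_neq1 I e m e_irr m_gt1 k.
have sI := @cox_gen_inj I e m e_irr m_gt1.
have : [set w'; w' * s i'] w' by left.
have : [set w'; w' * s i'] (w' * s i') by right.
(* In two of the four matchings of endpoints the edge at w' would collapse to a point, against s_i'
   <> 1; the other two are the identity and the flip. *)
rewrite -Eww' => -[w2|w2] [w1|w1]; rewrite w1 in w2 *.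
- by case: (s1 i'); apply: (@mulgI _ w); rewrite w2 mulg1.
- by split; [apply/sI/(@mulgI _ (w * s i)); rewrite w2 cox_genK|right].
- by split; [apply/sI/(@mulgI _ w); rewrite w2|left].
- by case: (s1 i'); apply: (@mulgI _ (w * s i)); rewrite w2 mulg1.
Qed.

Lemma edg_injr w : injective (edg w).
Proof. by move=> i j /edg_inj[]. Qed.

Lemma pol_sym w i j : e i j -> pol w i j = pol w j i.
Proof.
move=> eij; have eji : e j i by rewrite e_sym.
rewrite (polE w eij) (polE w eji); congr Polygon; apply: eq_exist => /=.
by rewrite finset.setUC classical_sets.setUC.
Qed.

Lemma pol_lcoset w w' i j : e i j ->
  lcoset_set w (dih i j) w' -> pol w i j = pol w' i j.
Proof.
move=> eij /lcoset_setP ww'; rewrite !(polE _ eij); congr Polygon.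
apply: eq_exist => /=; congr pair.
by apply/lcoset_set_eq => //; exact: generated_subgroup.
Qed.

Lemma pol_mull w i j : e i j -> pol (w * s i) i j = pol w i j.
Proof.
move=> eij; symmetry; apply: pol_lcoset => //; exists (s i) => //.
by apply: sub_generated; left.
Qed.

Lemma pol_mulr w i j : e i j -> pol (w * s j) i j = pol w i j.
Proof.
by move=> eij; rewrite pol_sym// (pol_sym w)// pol_mull// e_sym.
Qed.

Lemma face_vertex_edg w i : face (Vertex w) (edg w i).
Proof. by left. Qed.

Lemma dih1 w i j : lcoset_set w (dih i j) w.
Proof. by apply/lcoset_setP; rewrite mulVg; exact: (generated_subgroup _).1. Qed.

Lemma face_vertex_pol w i j : e i j -> face (Vertex w) (pol w i j).
Proof. by move=> eij; rewrite (polE w eij); exact: dih1. Qed.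

Lemma face_edg_pol w i j : e i j -> face (edg w i) (pol w i j).
Proof.
move=> eij; rewrite (polE w eij); exists w, i; split => //=; first exact: dih1.
by rewrite !inE eqxx.
Qed.

Lemma face_refl c : face c c.
Proof. by case: c. Qed.

Lemma face_vertexP w c : face (Vertex w) c ->
  [\/ c = Vertex w, exists i, c = edg w i |
      exists i j, e i j /\ c = pol w i j].
Proof.
case: (cellP c) => [w' /= <-|w' i /=|w' i j eij]; first by constructor 1.
- by move=> [->|->]; constructor 2; exists i; rewrite ?edg_flip.
- rewrite {1}(polE w' eij) /= => ww'; constructor 3; exists i, j.
  by split => //; exact: pol_lcoset.
Qed.

Lemma face_edgP w i c : face (edg w i) c ->
  c = edg w i \/ exists j, e i j /\ c = pol w i j.
Proof.
case: (cellP c) => [//|w' i' /= [wi]|w' a b eab].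
  by left; congr Edge; exact: eq_exist.
rewrite {1}(polE w' eab) /= => -[u [k [uw' kab wuk]]]; right.
have /edg_inj[ik uw] : edg w i = edg u k by congr Edge; exact: eq_exist.
rewrite -{}ik in kab; rewrite (pol_lcoset eab uw').
have -> : pol u a b = pol w a b.
  case: uw => [->//|->].
  by move: kab; rewrite !inE => /orP[] /eqP ->; rewrite ?pol_mull ?pol_mulr.
move: kab; rewrite !inE => /orP[] /eqP ->; first by exists b.
by exists a; rewrite e_sym pol_sym.
Qed.

Lemma edg_in_pol w k i j : e i j -> face (edg w k) (pol w i j) -> k = i \/ k = j.
Proof.
move=> eij; rewrite (polE w eij) /= => -[u [k' [_ kij wuk]]].
have /edg_inj[-> _] : edg w k = edg u k' by congr Edge; exact: eq_exist.
by move: kij; rewrite !inE => /orP[] /eqP ->; [left|right].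
Qed.

End Cells.

(** * Automorphisms of X and permutations of types *)

Section Automorphisms.
Variables (I : finType) (e : rel I) (m : nat).
Hypotheses (e_sym : symmetric e) (e_irr : irreflexive e) (m_gt1 : (1 < m)%N).
Local Notation W := (coxeter e m).
Local Notation s := (@cox_gen I e m).
Local Notation cell := (cell e m).
Local Notation autX := (autX e m).
Implicit Types (c d x : cell) (w : W) (i j k : I) (g h : autX).

Definition adj c d := face c d \/ face d c.

Lemma adj_refl c : adj c c.
Proof. by left; exact: face_refl. Qed.

Lemma adj_sym c d : adj c d -> adj d c.
Proof. by case; [right|left]. Qed.

Lemma face_rank c d : face c d -> (rank c <= rank d)%N.
Proof. by case: c; case: d. Qed.

Lemma face_eq_rank c d : face c d -> rank c = rank d -> c = d.
Proof. by case: c; case: d. Qed.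

Lemma adj_face c d : adj c d -> (rank c <= rank d)%N -> face c d.
Proof.
move=> [//|dc] cd; have rdc : rank d = rank c.
  by apply/eqP; rewrite eqn_leq cd face_rank.
by rewrite (face_eq_rank dc rdc); exact: face_refl.
Qed.

Lemma simplex2 c d : simplex [set c; d] <-> adj c d.
Proof.
split=> [[_]|cd]; first by apply; [left|right].
split; first by exists c; left.
by move=> _ _ [->|->] [->|->]; [exact: adj_refl| |exact: adj_sym|exact: adj_refl].
Qed.

Lemma simplex3 x c d :
  simplex [set x; c; d] <-> [/\ adj x c, adj x d & adj c d].
Proof.
split=> [[_ xcd]|[xc xd cd]].
  by split; apply: xcd; rewrite /=; tauto.
split; first by exists x; left; left.
have [adjR adjS] := (adj_refl, adj_sym).
by move=> c1 d1 /=; rewrite -/(adj c1 d1) => -[[]|] -> [[]|] ->; auto.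
Qed.

Lemma adj_vertexP w c : adj (Vertex w) c ->
  [\/ c = Vertex w, exists i, c = edg w i |
      exists i j, e i j /\ c = pol w i j].
Proof.
by case=> [|cw]; [exact: face_vertexP|constructor 1; case: c cw].
Qed.

Lemma adj_vertex_edg w i : adj (Vertex w) (edg w i).
Proof. by left; exact: face_vertex_edg. Qed.

Lemma adj_vertex_pol w i j : e i j -> adj (Vertex w) (pol w i j).
Proof. by left; exact: face_vertex_pol. Qed.

Lemma adj_edg_pol w i j : e i j -> adj (edg w i) (pol w i j).
Proof. by left; exact: face_edg_pol. Qed.

(* A map between the stars of two vertices is a permutation of I, since a cell
   of the star of [w] is determined by its type. *)
Lemma star_map (h : cell -> cell) w w' :
  h (Vertex w) = Vertex w' ->
  (forall c, adj (Vertex w) c -> rank (h c) = rank c) ->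
  (forall c d, adj (Vertex w) c -> adj (Vertex w) d -> adj c d ->
     adj (h c) (h d)) ->
  (forall c d, adj (Vertex w) c -> adj (Vertex w) d -> h c = h d -> c = d) ->
  exists p : {perm I}, (forall k, h (edg w k) = edg w' (p k)) /\
    forall i j, e i j -> e (p i) (p j) /\ h (pol w i j) = pol w' (p i) (p j).
Proof.
move=> hw hr ha hI; have we := adj_vertex_edg w.
have hE k : exists k', h (edg w k) = edg w' k'.
  have := ha _ _ (adj_refl _) (we k) (we k); rewrite hw => /adj_vertexP.
  have := hr _ (we k) => /[swap].
  case=> [->//|[k' ->]|[a [b [eab ->]]]]; first by exists k'.
  by rewrite rank_pol.
have [t ht] := choice hE.
have tI : injective t.
  move=> i j tij; apply: (edg_injr e_irr m_gt1 (w := w)).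
  by apply: hI => //; rewrite !ht tij.
exists (perm tI); split=> [k|i j eij]; rewrite !permE; first exact: ht.
have wp := adj_vertex_pol w eij.
have rp := hr _ wp; rewrite (rank_pol _ eij) in rp.
have /adj_face := ha _ _ (we i) wp (adj_edg_pol w eij).
rewrite ht rp => /(_ isT) /(face_edgP e_sym e_irr m_gt1)[pE|[b [eb pE]]].
  by rewrite pE in rp.
(* Containing the image of the edge of type i, the image polygon is [pol w' (t i) b] for some b;
   containing that of type j as well, it has b = t j, since t is injective. *)
have /adj_face : adj (h (edg w j)) (h (pol w i j)).
  by apply: ha => //; rewrite pol_sym//; apply: adj_edg_pol; rewrite e_sym.
rewrite ht pE rank_pol// => /(_ isT).
case/(edg_in_pol e_irr m_gt1 eb) => [/tI ji|->]; last by split.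
by rewrite ji e_irr in eij.
Qed.

Lemma aut_inj g : injective g.
Proof. exact: can_inj (aut_funK g). Qed.

Lemma aut_adj g c d : adj (g c) (g d) <-> adj c d.
Proof.
by rewrite -!simplex2 -(aut_simplex g [set c; d]) image_setU !image_set1.
Qed.

Lemma aut_face g c d : face (g c) (g d) <-> face c d.
Proof.
split=> cd; (apply: adj_face; last by move: (face_rank cd); rewrite !aut_rank);
  by apply/(aut_adj g); left.
Qed.

Lemma aut_mulE g h c : (g * h) c = g (h c).
Proof. by []. Qed.

Lemma aut_invE g c : g^-1 (g c) = c.
Proof. exact: aut_funK. Qed.

Lemma aut_invE' g c : g (g^-1 c) = c.
Proof. exact: aut_invK. Qed.

Lemma aut_star g w : exists q : W * {perm I},
  [/\ g (Vertex w) = Vertex q.1,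
      forall k, g (edg w k) = edg q.1 (q.2 k) &
      forall i j, e i j ->
        e (q.2 i) (q.2 j) /\ g (pol w i j) = pol q.1 (q.2 i) (q.2 j)].
Proof.
have [w' gw] : exists w', g (Vertex w) = Vertex w'.
  by have := aut_rank g (Vertex w); case: (g _) => // w' _; exists w'.
have [|c d _ _|c d _ _|p [pE pP]] := @star_map g w w' gw.
- by move=> c _; exact: aut_rank.
- by move/(aut_adj g).
- exact: aut_inj.
- by exists (w', p).
Qed.

(** Coordinates of an automorphism: its action on W, and at each vertex the permutation of types
    that it induces there. By [aut_eq] they determine it. *)
Definition vtx g w : W := (projT1 (cid (aut_star g w))).1.
Definition tau g w : {perm I} := (projT1 (cid (aut_star g w))).2.

Lemma aut_vertex g w : g (Vertex w) = Vertex (vtx g w).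
Proof. by rewrite /vtx; case: cid => q []. Qed.

Lemma aut_edg g w k : g (edg w k) = edg (vtx g w) (tau g w k).
Proof. by rewrite /vtx /tau; case: cid => q []. Qed.

Lemma aut_pol g w i j : e i j ->
  g (pol w i j) = pol (vtx g w) (tau g w i) (tau g w j).
Proof.
move=> eij; have [_ _ gP] := projT2 (cid (aut_star g w)).
by have [_ ->] := gP i j eij.
Qed.

Lemma vtx_unique g w w' : g (Vertex w) = Vertex w' -> vtx g w = w'.
Proof. by rewrite aut_vertex => -[]. Qed.

Lemma tau_unique g w w' (p : {perm I}) : 
  (forall k, g (edg w k) = edg w' (p k)) -> vtx g w = w' -> tau g w = p.
Proof.
move=> gp gw; apply/permP => k; apply: (edg_injr e_irr m_gt1 (w := w')).
by rewrite -gp aut_edg gw.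
Qed.

(** Writing the image of an edge from both of its ends leaves two candidates for the image of the
    second end; injectivity on vertices excludes the image of the first. *)
Lemma vtx_gen g w i : vtx g (w * s i) = vtx g w * s (tau g w i).
Proof.
have := aut_edg g (w * s i) i; rewrite edg_flip aut_edg.
move=> /(edg_inj e_irr m_gt1)[_ [|//]] ww.
have /aut_inj[] : g (Vertex (w * s i)) = g (Vertex w) by rewrite !aut_vertex ww.
rewrite -[RHS]mulg1 => /mulgI /cox_gen_neq1 []//.
Qed.

Lemma aut_eq g h : vtx g =1 vtx h -> tau g =1 tau h -> g = h.
Proof.
move=> ghv ght; apply: autX_eq => c; case: (cellP c) => [w|w i|w i j eij].
- by rewrite !aut_vertex ghv.
- by rewrite !aut_edg ghv ght.
- by rewrite !aut_pol// ghv ght.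
Qed.

Lemma vtxM g h w : vtx (g * h) w = vtx g (vtx h w).
Proof. by apply: vtx_unique; rewrite aut_mulE !aut_vertex. Qed.

(** A cocycle identity. Products in [{perm I}] apply the left factor first, hence the reversed
    order. *)
Lemma tauM g h w : tau (g * h) w = tau h w * tau g (vtx h w).
Proof.
apply: tau_unique (vtxM g h w) => k.
by rewrite permM aut_mulE !aut_edg.
Qed.

Lemma vtx1 w : vtx 1 w = w.
Proof. exact: vtx_unique. Qed.

Lemma tau1 w : tau 1 w = 1.
Proof. by apply: tau_unique (vtx1 w) => k; rewrite perm1. Qed.

Lemma vtxK g w : vtx g^-1 (vtx g w) = w.
Proof. by rewrite -vtxM mulVg vtx1. Qed.

Lemma tauV g w : tau g^-1 (vtx g w) = (tau g w)^-1.
Proof.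
by apply: (@mulgI _ (tau g w)); rewrite -tauM mulVg tau1 mulgV.
Qed.

Lemma lmul_edg u w k : lmul u (edg w k) = edg (u * w) k.
Proof.
congr Edge; apply: eq_exist => /=.
by rewrite /lcoset_set image_setU !image_set1 mulgA.
Qed.

Lemma vtx_lmul u w : vtx (lmul u) w = u * w.
Proof. exact: vtx_unique. Qed.

Lemma tau_lmul u w : tau (lmul u) w = 1.
Proof. by apply: tau_unique (vtx_lmul u w) => k; rewrite perm1 lmul_edg. Qed.

(** An automorphism that keeps all types sends a path from 1 to the path from [vtx g 1] reading the
    same word, so it is left multiplication by [vtx g 1]. *)
Lemma W_in_autXP g : W_in_autX g <-> forall w, tau g w = 1.
Proof.
split=> [[u _ <-] w|tg]; first exact: tau_lmul.
exists (vtx g 1) => //; apply: aut_eq => w; last by rewrite tau_lmul tg.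
rewrite vtx_lmul; elim/cox_ind: w => [|w i IH]; first by rewrite mulg1.
by rewrite vtx_gen tg perm1 mulgA IH.
Qed.

Lemma W_in_autX_subgroup : subgroup (@W_in_autX I e m).
Proof.
split=> [|g h /W_in_autXP tg /W_in_autXP th].
  by apply/W_in_autXP; exact: tau1.
apply/W_in_autXP => w; rewrite tauM tg mulg1.
have <- : vtx h (vtx h^-1 w) = w by rewrite -vtxM mulgV vtx1.
by rewrite tauV th invg1.
Qed.

(* The combinatorial form of an endomorphism of X that is bijective on links:
   [f] on vertices, and [p w] on the types of the cells containing [w]. *)
Record typed_map (f : W -> W) (p : W -> {perm I}) : Prop := TypedMap {
  typed_map_gen : forall w i, f (w * s i) = f w * s (p w i);
  typed_map_adj : forall w i j, e (p w i) (p w j) = e i j;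
  typed_map_const : forall w i j, i = j \/ e i j -> p (w * s i) j = p w j
}.

Lemma typed_map_edg f p w i w' i' : typed_map f p -> edg w i = edg w' i' ->
  edg (f w) (p w i) = edg (f w') (p w' i').
Proof.
move=> [fg _ pc] /(edg_inj e_irr m_gt1)[<- [->//|->]].
by rewrite fg pc ?edg_flip//; left.
Qed.

(** The elements u whose right multiplication changes neither the types of i and j nor the image
    polygon form a subgroup H. It contains s_i and s_j, hence the dihedral subgroup that relates any
    two base points of a polygon. *)
Lemma typed_map_pol f p w i j w' i' j' : typed_map f p -> e i j -> e i' j' ->
  pol w i j = pol w' i' j' ->
  pol (f w) (p w i) (p w j) = pol (f w') (p w' i') (p w' j').
Proof.
move=> fp eij eij'; have [fg pa pc] := fp; have eji : e j i by rewrite e_sym.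
pose H : set W := [set u | forall w, [/\ p (w * u) i = p w i, p (w * u) j = p w j &
  pol (f (w * u)) (p w i) (p w j) = pol (f w) (p w i) (p w j)]].
have sH : subgroup H.
  split=> [v|x y Hx Hy v]; first by rewrite mulg1.
  have [xi xj xP] := Hx v; have := Hy (v * (x * y^-1)).
  have -> : v * (x * y^-1) * y = v * x by rewrite mulgA mulgKV.
  rewrite xi xj => -[<- <- yP]; split => //.
  by rewrite -yP xP.
have Hi : H (s i).
  move=> v; rewrite fg pol_mull ?pa//; split=> //; apply: pc; by [left|right].
have Hj : H (s j).
  move=> v; rewrite fg pol_mulr ?pa//; split=> //; apply: pc; by [left|right].
rewrite (polE w eij) (polE w' eij') => -[/setP ij ww'].
have /lcoset_setP ww : lcoset_set w (generated [set s i; s j]) w'.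
  by rewrite ww'; exact: dih1.
have [] := ww H sH _ w; first by move=> _ [->|->].
rewrite mulVKg => wi wj <-; rewrite -wi -wj.
have ij1 : (i' == i) || (i' == j) by have := ij i'; rewrite !inE eqxx.
have ij2 : (j' == i) || (j' == j) by have := ij j'; rewrite !inE eqxx orbT.
have neq : i' != j' by apply: contraTneq eij' => ->; rewrite e_irr.
case/orP: ij1 neq ij2 => /eqP -> /negbTE; rewrite eq_sym => ->; rewrite ?orbF /=.
  by move=> /eqP ->.
by move=> /eqP ->; rewrite pol_sym// pa.
Qed.

(** A cell has several coordinates, so [spec] asks for a value compatible with all of them at once;
    the two preceding lemmas show that it exists. *)
Lemma typed_map_cell f p : typed_map f p ->
  exists F : cell -> cell, [/\ forall w, F (Vertex w) = Vertex (f w),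
    forall w i, F (edg w i) = edg (f w) (p w i) &
    forall w i j, e i j -> F (pol w i j) = pol (f w) (p w i) (p w j)].
Proof.
move=> fp.
pose spec c d := [/\ forall w, c = Vertex w -> d = Vertex (f w),
  forall w i, c = edg w i -> d = edg (f w) (p w i) &
  forall w i j, e i j -> c = pol w i j -> d = pol (f w) (p w i) (p w j)].
have /choice[F FP] c : exists d, spec c d.
  case: (cellP c) => [w|w i|w i j eij].
  - exists (Vertex (f w)); split=> [w' [->] //|//|w' i j eij].
    by rewrite (polE w' eij).
  - exists (edg (f w) (p w i)); split=> [//|w' i'|w' i' j eij].
      exact: typed_map_edg.
    by rewrite (polE w' eij).
  - exists (pol (f w) (p w i) (p w j)); split=> [w'|w' i'|w' i' j' eij'].
    + by rewrite (polE w eij).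
    + by rewrite (polE w eij).
    + exact: typed_map_pol.
exists F; split=> [w|w i|w i j eij].
- by have [Fv _ _] := FP (Vertex w); exact: Fv.
- by have [_ Fe _] := FP (edg w i); exact: Fe.
- by have [_ _ Fp] := FP (pol w i j); exact: Fp.
Qed.

Lemma typed_map_inv f f' p : cancel f f' -> cancel f' f -> typed_map f p ->
  typed_map f' (fun v => (p (f' v))^-1).
Proof.
move=> fK f'K [fg pa pc].
have f'g v k : f' (v * s k) = f' v * s ((p (f' v))^-1%g k).
  by apply: (can_inj fK); rewrite fg !f'K permKV.
split=> [//|v i j|v i j ij]; first by rewrite -(pa (f' v)) !permKV.
set a := (p (f' v))^-1%g i; set b := (p (f' v))^-1%g j.
have ab : a = b \/ e a b.
  by case: ij => ij; [by rewrite /a /b ij; left|right; rewrite -(pa (f' v)) !permKV].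
rewrite -[j in LHS](permKV (p (f' v))) -/b -(pc _ a)// f'g -/a.
by rewrite permK.
Qed.

Lemma typed_map_face f p (F : cell -> cell) : typed_map f p ->
  (forall w, F (Vertex w) = Vertex (f w)) ->
  (forall w i, F (edg w i) = edg (f w) (p w i)) ->
  (forall w i j, e i j -> F (pol w i j) = pol (f w) (p w i) (p w j)) ->
  forall c d, face c d -> face (F c) (F d).
Proof.
move=> [fg pa pc] Fv Fe Fp c d; case: (cellP c) => [w|w i|w i j eij].
- move=> /(face_vertexP)[->|[i ->]|[i [j [eij ->]]]]; first exact: face_refl.
    by rewrite Fv Fe; exact: face_vertex_edg.
  by rewrite Fv Fp//; apply: face_vertex_pol; rewrite pa.
- move=> /(face_edgP e_sym e_irr m_gt1)[->|[j [eij ->]]]; first exact: face_refl.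
  by rewrite Fe Fp//; apply: face_edg_pol; rewrite pa.
- move=> cd; rewrite (_ : d = pol w i j); first exact: face_refl.
  apply/esym/face_eq_rank => //; rewrite rank_pol//.
  by have := face_rank cd; rewrite rank_pol//; case: d {cd} => // ? /=.
Qed.

Lemma typed_map_aut f f' p : cancel f f' -> cancel f' f -> typed_map f p ->
  exists phi : autX, vtx phi =1 f /\ tau phi =1 p.
Proof.
move=> fK f'K fp; have fp' := typed_map_inv fK f'K fp.
have [F [Fv Fe Fp]] := typed_map_cell fp.
have [F' [Fv' Fe' Fp']] := typed_map_cell fp'.
have FK : cancel F F'.
  move=> c; case: (cellP c) => [w|w i|w i j eij]; first by rewrite Fv Fv' fK.
    by rewrite Fe Fe' fK permK.
  by rewrite Fp// Fp' ?(typed_map_adj fp)// fK !permK.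
have F'K : cancel F' F.
  move=> c; case: (cellP c) => [w|w i|w i j eij]; first by rewrite Fv' Fv f'K.
    by rewrite Fe' Fe f'K permKV.
  by rewrite Fp'// Fp ?(typed_map_adj fp')// f'K !permKV.
have rF c : rank (F c) = rank c.
  case: (cellP c) => [w|w i|w i j eij]; first by rewrite Fv.
    by rewrite Fe.
  by rewrite Fp// !rank_pol// (typed_map_adj fp).
have simpl (G : cell -> cell) S : (forall c d, face c d -> face (G c) (G d)) ->
    simplex S -> simplex (G @` S).
  move=> Gf [[c Sc] SS]; split; first by exists (G c), c.
  by move=> _ _ [a Sa <-] [b Sb <-]; have [/Gf|/Gf] := SS a b Sa Sb; [left|right].
have sF S : simplex (F @` S) <-> simplex S.
  split; last exact: simpl (typed_map_face fp Fv Fe Fp).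
  move=> /(simpl _ _ (typed_map_face fp' Fv' Fe' Fp')).
  by rewrite image_comp (_ : F' \o F = id) ?image_id//; apply/funext.
have vF w : vtx (AutX FK F'K rF sF) w = f w by apply: vtx_unique; exact: Fv.
exists (AutX FK F'K rF sF); split=> // w.
by apply: tau_unique (vF w) => k; exact: Fe.
Qed.

End Automorphisms.

(** * Parallel transport of a flat connection *)

Section FlatConnection.
Variables (I : finType) (e : rel I) (m : nat).
Hypotheses (e_sym : symmetric e) (e_irr : irreflexive e) (m_gt1 : (1 < m)%N).
Local Notation W := (coxeter e m).
Local Notation s := (@cox_gen I e m).
Local Notation vtx := (vtx e_sym e_irr m_gt1).
Local Notation tau := (tau e_sym e_irr m_gt1).
Implicit Types (x y w : W) (i j k l : I).

Lemma iter_alternate x k l : e k l ->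
  iter m (fun y => y * s k * s l) x = x.
Proof.
move=> ekl; rewrite -(foldl_alternate (fun y k => y * s k)).
have fE u v : foldl (fun y k => y * s k) v u = v * cox_word e m u.
  elim: u v => [|i u IH] v /=; first by rewrite mulg1.
  by rewrite IH cox_word_cons mulgA.
by rewrite fE cox_gen_pow// mulg1.
Qed.

Variable con : W -> I -> {perm I}.

Definition con_step (z : W * {perm I}) i := (z.1 * s i, z.2 * con z.1 i).

(** In order: reflections are involutions, they fix the facet, they respect links, and they have
    trivial holonomy. *)
Record flat_connection : Prop := FlatConnection {
  con_rev : forall w i, con w i * con (w * s i) i = 1;
  con_fix : forall w i j, i = j \/ e i j -> con w i j = j;
  con_adj : forall w i j k, e (con w i j) (con w i k) = e j k;
  con_flat : forall i j z, e i j ->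
    iter m (fun z => con_step (con_step z i) j) z = z
}.

Hypothesis con_P : flat_connection.

Lemma con_step2 z i : con_step (con_step z i) i = z.
Proof.
case: z => w p; rewrite /con_step /= cox_genK -mulgA (con_rev con_P).
by rewrite mulg1.
Qed.

Let act z w := cox_act con_step z w.
Let actM z w i : act z (w * s i) = con_step (act z w) i.
Proof.
apply: cox_actM; first exact: con_step2.
by move=> *; exact: (con_flat con_P).
Qed.

Let act1 z : act z 1 = z.
Proof.
apply: cox_act1; first exact: con_step2.
by move=> *; exact: (con_flat con_P).
Qed.

(** The product of [con] along any path from 1 to w: [con_rev] and [con_flat] say exactly that
    [con_step] satisfies the relators of W. *)
Definition transport w : {perm I} := (act (1, 1) w).2.

Lemma transport_gen w i : transport (w * s i) = transport w * con w i.
Proof.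
suff act_fst v : (act (1, 1) v).1 = v by rewrite /transport actM /= act_fst.
elim/cox_ind: v => [|v j IH]; first by rewrite act1.
by rewrite actM /= IH.
Qed.

Lemma transport_adj w i j : e (transport w i) (transport w j) = e i j.
Proof.
elim/cox_ind: w => [|w k IH]; first by rewrite /transport act1 !perm1.
by rewrite transport_gen !permM (con_adj con_P).
Qed.

(** The edge crossed has type [transport w i], and by [con_fix] the connection fixes this type and
    its neighbours. *)
Lemma transport_const w i j : i = j \/ e i j ->
  transport (w * s (transport w i)) j = transport w j.
Proof.
move=> ij; rewrite transport_gen permM (con_fix con_P)//.
by case: ij => [->|ij]; [left|right; rewrite transport_adj].
Qed.

Lemma transportV_const w k l : k = l \/ e k l ->
  (transport (w * s k))^-1%g l = (transport w)^-1%g l.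
Proof.
move=> kl; rewrite transport_gen invMg permM.
by rewrite -{1}(con_fix con_P w kl) permK.
Qed.

Lemma transportV_adj w i j : e ((transport w)^-1%g i) ((transport w)^-1%g j) = e i j.
Proof. by rewrite -(transport_adj w) !permKV. Qed.

(* [unfold] reads a word of W as a path along the transported types, and [fold]
   reads off the transported types along a path. *)
Let unfold_step x i : W := x * s (transport x i).
Let unfold w := cox_act unfold_step 1 w.

Let fold_step (z : W * W) k : W * W := (z.1 * s ((transport z.2)^-1%g k), z.2 * s k).
Let fold2 w := cox_act fold_step (1, 1) w.

Let unfold_step2 x i : unfold_step (unfold_step x i) i = x.
Proof. by rewrite /unfold_step transport_const ?cox_genK//; left. Qed.

(** Along the path the transported types of i and j keep their initial values k and l, so it
    alternates s_k and s_l and closes up after m rounds. The induction carries this constancy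
    along. *)
Let unfold_step_edge x i j : e i j ->
  iter m (fun y => unfold_step (unfold_step y i) j) x = x.
Proof.
move=> eij; set k := transport x i; set l := transport x j.
suff unf n y : y = iter n (fun y => y * s k * s l) x ->
    iter n (fun y => unfold_step (unfold_step y i) j) x = y /\
    (transport y i = k /\ transport y j = l).
  by have [] := unf m x; rewrite ?iter_alternate ?transport_adj.
elim: n y => [|n IH] y yE; first by rewrite yE.
have [/= -> [Ti Tj]] := IH _ erefl.
set z := iter n _ x in yE Ti Tj *.
have Tzi : transport (z * s k) i = k by rewrite -Ti transport_const//; left.
have Tzj : transport (z * s k) j = l by rewrite -Ti transport_const//; right.
rewrite /unfold_step Ti Tzj; split=> //; rewrite yE /= -/z.
have eji : e j i by rewrite e_sym.
by rewrite -Tzj !transport_const//; [left|right].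
Qed.

Let fold_step2 z k : fold_step (fold_step z k) k = z.
Proof.
rewrite /fold_step /= transportV_const; last by left.
by rewrite !cox_genK; case: z.
Qed.

Let fold_step_edge z k l : e k l ->
  iter m (fun v => fold_step (fold_step v k) l) z = z.
Proof.
move=> ekl; set i := (transport z.2)^-1%g k; set j := (transport z.2)^-1%g l.
have elk : e l k by rewrite e_sym.
suff fol n : iter n (fun v => fold_step (fold_step v k) l) z =
    (iter n (fun y => y * s i * s j) z.1, iter n (fun y => y * s k * s l) z.2) /\
    ((transport (iter n (fun y => y * s k * s l) z.2))^-1%g k = i /\
     (transport (iter n (fun y => y * s k * s l) z.2))^-1%g l = j).
  have [-> _] := fol m; rewrite !iter_alternate// ?transportV_adj//.
  by case: (z).
elim: n => [|n [/= -> [Ti Tj]]]; first by case: (z) @i @j.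
rewrite /fold_step /= Ti transportV_const; last by right.
rewrite Tj; split=> //.
rewrite [X in X = i]transportV_const; last by right.
rewrite [X in _ /\ X = _]transportV_const; last by left.
by rewrite !transportV_const//; [right|left].
Qed.

Lemma flat_connection_aut : exists phi : autX e m, forall w i,
  tau phi (w * s i) = tau phi w * con (vtx phi w) (tau phi w i).
Proof.
have unfoldM w i : unfold (w * s i) = unfold_step (unfold w) i.
  exact: (cox_actM unfold_step2 unfold_step_edge).
have unfold1 : unfold 1 = 1 by exact: (cox_act1 unfold_step2 unfold_step_edge).
have foldM w i : fold2 (w * s i) = fold_step (fold2 w) i.
  exact: (cox_actM fold_step2 fold_step_edge).
have fold1 : fold2 1 = (1, 1) by exact: (cox_act1 fold_step2 fold_step_edge).
(* The second component is the current vertex, whose transport the next step needs. *)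
have fold_snd w : (fold2 w).2 = w.
  by elim/cox_ind: w => [|w i IH]; [rewrite fold1|rewrite foldM /= IH].
pose fold w := (fold2 w).1.
have fold_gen w k : fold (w * s k) = fold w * s ((transport w)^-1%g k).
  by rewrite /fold foldM /= fold_snd.
have unfoldK : cancel unfold fold.
  elim/cox_ind=> [|w i IH]; first by rewrite unfold1 /fold fold1.
  by rewrite unfoldM /unfold_step fold_gen IH permK.
have foldK : cancel fold unfold.
  elim/cox_ind=> [|w i IH]; first by rewrite /fold fold1 unfold1.
  by rewrite fold_gen unfoldM /unfold_step IH permKV.
(* The type map at w is the transport at the image of w, so [transport_gen] becomes the required
   recursion. *)
have typ : typed_map unfold (fun w => transport (unfold w)).
  split=> [//|w i j|w i j ij]; first exact: transport_adj.
  by rewrite unfoldM transport_const.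
have [phi [vphi tphi]] := typed_map_aut e_sym e_irr m_gt1 unfoldK foldK typ.
exists phi => w i; rewrite !tphi vphi unfoldM.
by rewrite transport_gen.
Qed.

End FlatConnection.

(** * Conjugating automorphisms that preserve a connection *)

Section ConjugateLattice.
Variables (I : finType) (e : rel I) (m : nat).
Hypotheses (e_sym : symmetric e) (e_irr : irreflexive e) (m_gt1 : (1 < m)%N).
Local Notation W := (coxeter e m).
Local Notation s := (@cox_gen I e m).
Local Notation vtx := (vtx e_sym e_irr m_gt1).
Local Notation tau := (tau e_sym e_irr m_gt1).
Implicit Types (g h phi : autX e m).

(** Since phi carries the trivial connection to [con] and g preserves [con], the conjugate preserves
    the trivial connection: its types do not change across an edge. *)
Lemma conj_tau_const (con : W -> I -> {perm I}) phi g :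
  (forall w i, tau phi (w * s i) = tau phi w * con (vtx phi w) (tau phi w i)) ->
  (forall w i, con w i * tau g (w * s i) = tau g w * con (vtx g w) (tau g w i)) ->
  forall w, tau (phi^-1 * g * phi) w = tau (phi^-1 * g * phi) 1.
Proof.
move=> phi_con g_con; set h := phi^-1 * g * phi.
have phi_h : phi * h = g * phi by rewrite /h -!mulgA mulVKg.
elim/cox_ind=> // w i <-.
(* With these two factors added, both sides are [tau (phi * h) (w * s i)], expanded once through phi
   * h and once through g * phi. *)
apply: (@mulIg _ (tau phi (vtx h w))); rewrite -[RHS]tauM phi_h.
apply: (@mulIg _ (con (vtx (g * phi) w) (tau (g * phi) w i))).
transitivity (tau (phi * h) (w * s i)).
  rewrite [RHS]tauM vtx_gen phi_con -!vtxM phi_h -mulgA.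
  by congr (_ * (_ * con _ _)); rewrite -phi_h tauM permM.
rewrite phi_h !tauM vtx_gen phi_con -!mulgA g_con vtxM.
by rewrite permM.
Qed.

Lemma tau_const_quotient g h :
  (forall w, tau g w = tau g 1) -> (forall w, tau h w = tau h 1) ->
  tau g 1 = tau h 1 -> W_in_autX (g^-1 * h).
Proof.
move=> cg ch gh; apply/(W_in_autXP e_sym e_irr m_gt1) => w.
rewrite tauM ch -gh -[in X in _ * X](vtxK e_sym e_irr m_gt1 g^-1 (vtx h w)) invgK.
by rewrite tauV cg mulgV.
Qed.

End ConjugateLattice.

(** * Local reflections *)

Section Blocks.
Variables (I : finType) (e : rel I) (m : nat).
Hypotheses (e_sym : symmetric e) (e_irr : irreflexive e) (m_gt1 : (1 < m)%N).
Local Notation W := (coxeter e m).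
Local Notation s := (@cox_gen I e m).
Local Notation cell := (cell e m).
Implicit Types (c d x v : cell) (w : W) (i j k : I) (g : autX e m).

Lemma ends_edg w i : ends (edg w i) = [set Vertex w; Vertex (w * s i)].
Proof.
apply/seteqP; split=> [[u|E|P] [] //= _ [->|->]|_ [->|->]]; [by left|by right| |].
- by split=> //; left.
- by split=> //; right.
Qed.

Lemma Vertex_gen_neq w i : Vertex w <> Vertex (w * s i).
Proof.
by move=> [/esym]; rewrite -[RHS]mulg1 => /mulgI /(cox_gen_neq1 e_irr m_gt1).
Qed.

Lemma vertices_block x c : vertices (block x) c <-> adj x c.
Proof.
rewrite -simplex2; split=> [[_]//|xc].
by split=> //; exists c.
Qed.

Lemma block2 x c d : adj x c -> adj x d -> adj c d -> block x [set c; d].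
Proof.
move=> xc xd cd; split; first by exists c; left.
by rewrite setUA; apply/simplex3.
Qed.

Lemma block_union2 v c d : block_union v [set c; d] -> adj c d.
Proof. by move=> [x _ [_ [_ xcd]]]; apply: xcd; right; [left|right]. Qed.

Lemma vertices_block_union v x c :
  ends v x -> adj x c -> vertices (block_union v) c.
Proof. by move=> vx xc; exists x => //; exact/vertices_block. Qed.

Lemma vertices_facetP v c :
  vertices (facet v) c <-> forall x, ends v x -> adj x c.
Proof.
by split=> vc x vx; apply/vertices_block; exact: vc.
Qed.

Lemma aut_ends g v x : ends (g v) (g x) <-> ends v x.
Proof.
rewrite /ends /= aut_rank.
by split=> -[-> xv]; split=> //; apply/(aut_face g).
Qed.

(** [star_map] applies because two adjacent cells in the star of w span a simplex of U(v), which a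
    local reflection preserves. *)
Lemma local_reflection_star w i f : local_reflection (edg w i) f ->
  exists p : {perm I}, (forall k, f (edg w k) = edg (w * s i) (p k)) /\
    forall a b, e a b ->
      e (p a) (p b) /\ f (pol w a b) = pol (w * s i) (p a) (p b).
Proof.
move=> [[fB fr fK] _ f_swap _].
have vw : ends (edg w i) (Vertex w) by rewrite ends_edg; left.
have vws : ends (edg w i) (Vertex (w * s i)) by rewrite ends_edg; right.
have inU c : adj (Vertex w) c -> vertices (block_union (edg w i)) c.
  exact: vertices_block_union.
apply: (star_map e_sym e_irr m_gt1).
- by apply: f_swap => //; exact: Vertex_gen_neq.
- by move=> c /inU; exact: fr.
- move=> c d wc wd cd; apply: (@block_union2 (edg w i)).
  have cdU : [set c; d] `<=` vertices (block_union (edg w i)).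
    by move=> _ [->|->]; exact: inU.
  have := (fK _ cdU).2; rewrite image_setU !image_set1; apply.
  by exists (Vertex w) => //; exact: block2.
- by move=> c d /inU Uc /inU Ud; apply: (set_bij_inj fB); exact/mem_set.
Qed.

End Blocks.

(** * Reflections of W and their pullbacks *)

Section StandardReflections.
Variables (I : finType) (e : rel I) (m : nat).
Hypotheses (e_sym : symmetric e) (e_irr : irreflexive e) (m_gt1 : (1 < m)%N).
Local Notation W := (coxeter e m).
Local Notation s := (@cox_gen I e m).
Local Notation cell := (cell e m).
Implicit Types (c d x v : cell) (w : W) (i j k : I) (g r : autX e m).

(** The global version, for automorphisms of all of X; by [reflection_local] it restricts to a local
    reflection. *)
Definition reflection v r : Prop :=
  [/\ r v = v, forall c, r (r c) = c,
      forall x y, ends v x -> ends v y -> x <> y -> r x = y &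
      forall c, vertices (facet v) c -> r c = c].

Lemma reflection_local v r : reflection v r -> local_reflection v r.
Proof.
move=> [rv rK r_swap r_fix].
have r_ends x : ends v (r x) <-> ends v x by rewrite -{1}rv aut_ends.
have r_simplex (K : set cell) : K !=set0 ->
    block_union v (r @` K) <-> block_union v K.
  move=> K0; split=> [[x vx [_ xK]]|[x vx [_ xK]]].
    exists (r x); first by apply/r_ends.
    split=> //; rewrite -(aut_simplex r) image_setU image_set1 rK.
    by [].
  exists (r x); first by apply/r_ends.
  split; first by case: K0 => c Kc; exists (r c), c.
  by move: xK; rewrite -(aut_simplex r) image_setU image_set1.
have r_U c : vertices (block_union v) (r c) <-> vertices (block_union v) c.
  by rewrite /vertices /= -image_set1; apply: r_simplex; exists c.
split=> //; split=> [|c _|S _]; last first.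
- have [/eqP ->|/set0P S0] := boolP (S == set0); last exact: r_simplex.
  by rewrite image_set0.
- exact: aut_rank.
- split=> [c /r_U //|c d _ _|c Uc]; first exact: aut_inj.
  by exists (r c) => //; apply/r_U.
Qed.

Lemma reflection_conj g v r : reflection (g v) r -> reflection v (g^-1 * r * g).
Proof.
move=> [rv rK r_swap r_fix]; split=> [|c|x y vx vy xy|c /vertices_facetP vc].
- by rewrite !aut_mulE rv aut_invE.
- by rewrite !aut_mulE aut_invE' rK aut_invE.
- rewrite !aut_mulE (r_swap (g x) (g y)) ?aut_invE//; [exact/aut_ends..|].
  by move/aut_inj.
- rewrite !aut_mulE r_fix ?aut_invE//; apply/vertices_facetP => x gvx.
  by rewrite -(aut_invE' g x) aut_adj; apply: vc; rewrite -(aut_ends g) aut_invE'.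
Qed.

(* Junk value 1 when [v] is not the center of an edge. *)
Definition refl_elt (v : cell) : W :=
  xget 1 [set u | exists w i, v = edg w i /\ u = w * s i * w^-1].

Lemma refl_elt_edg w i : refl_elt (edg w i) = w * s i * w^-1.
Proof.
rewrite /refl_elt; case: xgetP => [u _ [w' [j [E ->]]]|/(_ (w * s i * w^-1))].
  have [<- [->//|->]] := edg_inj e_irr m_gt1 E.
  rewrite cox_genK invgM mulgA; congr (_ * _ * _).
  by apply: (@mulgI _ (s i)); rewrite mulgV cox_gen2.
by case; exists w, i.
Qed.

Definition std_refl v : autX e m := lmul (refl_elt v).

Lemma std_reflE w i : std_refl (edg w i) = lmul (w * s i * w^-1).
Proof. by rewrite /std_refl refl_elt_edg. Qed.

Lemma lmulM u w c : lmul u (lmul w c) = lmul (u * w) c.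
Proof. exact: lmul_cellM. Qed.

Lemma lmul1E c : lmul 1 c = c.
Proof. exact: lmul_cell1. Qed.

Lemma lmul_pol u w i j : e i j -> lmul u (pol w i j) = pol (u * w) i j.
Proof.
move=> eij.
rewrite (aut_pol e_sym e_irr m_gt1)// tau_lmul vtx_lmul !perm1.
by [].
Qed.

Lemma std_refl_reflection w i : reflection (edg w i) (std_refl (edg w i)).
Proof.
rewrite std_reflE; set u := _ * w^-1.
have uw : u * w = w * s i by rewrite /u mulgKV.
have uws : u * (w * s i) = w by rewrite mulgA uw cox_genK.
have uu : u * u = 1 by rewrite {2}/u !mulgA uw cox_genK mulgV.
split.
- by rewrite lmul_edg uw edg_flip.
- by move=> c; rewrite lmulM uu; exact: lmul_cell1.
- move=> x y; rewrite ends_edg => -[->|->] [->|->] //= _.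
  + by rewrite uw.
  + by rewrite uws.
(* A cell adjacent to both w and w s_i is the edge itself or a polygon whose coset contains both;
   left multiplication by u moves w to w s_i, so it fixes either. *)
- move=> c /vertices_facetP; rewrite ends_edg => ec.
  have /adj_vertexP cw := ec _ (or_introl erefl).
  have /adj_vertexP cws := ec _ (or_intror erefl).
  case: cw => [cw|[j cw]|[j [k [ejk cw]]]].
  + rewrite cw in cws; case: cws => [|[a]|[a [b [eab]]]] //.
      by move/(Vertex_gen_neq e_irr m_gt1).
    by rewrite (polE _ eab).
  + rewrite {}cw in cws *; case: cws => [//|[k jk]|[a [b [eab]]]]; last first.
      by rewrite (polE _ eab).
    rewrite lmul_edg uw; have [kj _] := edg_inj e_irr m_gt1 jk.
    by rewrite jk kj.
  + move: ec => {cws}; rewrite {c}cw lmul_pol// uw => ec.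
    symmetry; apply: pol_lcoset => //.
    have /adj_face : adj (Vertex (w * s i)) (pol w j k) by apply: ec; right.
    by rewrite (polE _ ejk) /=; apply.
Qed.
Lemma rank1P v : rank v = 1%N -> exists w i, v = edg w i.
Proof.
case: (cellP v) => [//|w i _|w i j eij]; first by exists w, i.
by rewrite rank_pol.
Qed.

Lemma std_refl_lmul u v c : rank v = 1%N ->
  std_refl (lmul u v) (lmul u c) = lmul u (std_refl v c).
Proof.
move=> /rank1P[w [i ->]].
by rewrite lmul_edg !std_reflE !lmulM invgM !mulgA mulgKV.
Qed.

Definition refl_system g : cell -> cell -> cell :=
  fun v => g^-1 * std_refl (g v) * g.

Lemma refl_system_local g : local_reflection_system (refl_system g).
Proof.
move=> v rv; apply/reflection_local/reflection_conj.
have /rank1P[w [i ->]] : rank (g v) = 1%N by rewrite aut_rank.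
exact: std_refl_reflection.
Qed.

Lemma refl_system_preserves g :
  preserves [set h | W_in_autX (g * h * g^-1)] (refl_system g).
Proof.
move=> h /= [u _ gh] v rv c _.
suff: h (g^-1 (std_refl (g (h^-1 v)) (g (h^-1 c)))) = g^-1 (std_refl (g v) (g c)).
  by [].
set v' := h^-1 v; set c' := h^-1 c.
have gE d : g (h d) = lmul u (g d) by rewrite gh !aut_mulE aut_invE.
rewrite -[v in RHS](aut_invE' h) -[c in RHS](aut_invE' h) !gE.
rewrite std_refl_lmul ?aut_rank//.
by apply: (@aut_inj _ _ _ g); rewrite gE !aut_invE'.
Qed.

(** Crossing the edge from w to w s_i multiplies on the left by w s_i w^-1. These factors telescope,
    so the composite depends only on the ends of the path. *)
Lemma refl_system_holonomy g x a y w u : edge_path x a y ->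
  g x = Vertex w -> g y = Vertex u ->
  forall c, holonomy (refl_system g) a c = g^-1 (lmul (u * w^-1) (g c)).
Proof.
elim: a x w => [|v a IH] x w => [->|[z [rv vxz xz za]]] gx gy c.
  have [->] : Vertex u = Vertex w :> cell by rewrite -gx gy.
  by rewrite mulgV lmul1E aut_invE.
have vx : ends v x by rewrite vxz; left.
have vz : ends v z by rewrite vxz; right.
have [i gv] : exists i, g v = edg w i.
  have [_] := (aut_ends g v x).2 vx; rewrite gx => /face_vertexP[gv|//|].
    by move: rv; rewrite -(aut_rank g) gv.
  by move=> [i [j [eij gv]]]; move: rv; rewrite -(aut_rank g) gv rank_pol.
have gz : g z = Vertex (w * s i).
  have := (aut_ends g v z).2 vz; rewrite gv ends_edg => -[gz|//].
  by case: xz; apply: (aut_inj (g := g)); rewrite gx gz.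
rewrite [LHS](IH _ _ za gz gy).
rewrite {1}/refl_system !aut_mulE aut_invE' gv std_reflE lmulM.
by rewrite invgM !mulgA !mulgKV.
Qed.

Lemma refl_system_trivial_holonomy g : trivial_holonomy (refl_system g).
Proof.
move=> x v p a [rx _ _ _] [xa _ _ _] c _.
have [w gx] : exists w, g x = Vertex w.
  by move: rx; rewrite -(aut_rank g); case: (g x) => // w _; exists w.
by rewrite (refl_system_holonomy xa gx gx) mulgV lmul1E aut_invE.
Qed.

End StandardReflections.

(** * Boundary paths of polygons *)

Section AlternatingPaths.
Variables (I : finType) (e : rel I) (m : nat).
Hypotheses (e_sym : symmetric e) (e_irr : irreflexive e) (m_gt1 : (1 < m)%N).
Local Notation W := (coxeter e m).
Local Notation s := (@cox_gen I e m).
Local Notation cell := (cell e m).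
Implicit Types (c d v : cell) (w x y : W) (i j k : I) (u : seq I).

Fixpoint word_path w u : seq cell :=
  if u is i :: u' then edg w i :: word_path (w * s i) u' else [::].

Lemma size_word_path w u : size (word_path w u) = size u.
Proof. by elim: u w => //= i u IH w; rewrite IH. Qed.

Lemma edge_path_word_path w u :
  edge_path (Vertex w) (word_path w u) (Vertex (w * cox_word e m u)).
Proof.
elim: u w => [|i u IH] w /=; first by rewrite mulg1.
exists (Vertex (w * s i)); split=> //; first exact: ends_edg.
  exact: Vertex_gen_neq.
by rewrite cox_word_cons mulgA.
Qed.

Lemma face_alternating_path w i j n v : e i j ->
  v \in word_path w (flatten (nseq n [:: i; j])) -> face v (pol w i j).
Proof.
move=> eij; have eji : e j i by rewrite e_sym.
elim: n w => //= n IH w; rewrite !inE => /or3P[/eqP ->|/eqP ->|/IH].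
- exact: face_edg_pol.
- by rewrite -pol_mull// pol_sym//; exact: face_edg_pol.
- by rewrite pol_mulr// pol_mull.
Qed.

(* The edges [edg (w * y) k], [y] in W, are labelled by an edge of the 2m-cycle
   on which W acts through [dih_act]. *)
Let dih_edge i k (z : bool * 'I_m) : 'I_m :=
  if (k == i) || z.1 then z.2 else ord_pred z.2.

Let dih_edge_step i k z : dih_edge i k (dih_step i z k) = dih_edge i k z.
Proof.
rewrite /dih_edge /dih_step; case: eqP => //= _.
by case: z => [[] q] //=; rewrite ordSK.
Qed.

Let dih_label i (w x : W) k : bool * nat :=
  (k == i, val (dih_edge i k (dih_act m_gt1 i (w^-1 * x)))).

(** By [edge_labelE] the coordinates picked by [xget] do not matter, so edges with distinct labels
    are distinct. *)
Let edge_label i w c : bool * nat :=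
  let xk := xget (1, i) [set xk : W * I | c = edg xk.1 xk.2] in
  dih_label i w xk.1 xk.2.

Let edge_labelE i w x k : edge_label i w (edg x k) = dih_label i w x k.
Proof.
rewrite /edge_label; case: xgetP => [[y j] _ /= E|/(_ (x, k))]; last by case.
have [<- [->//|->]] := edg_inj e_irr m_gt1 E.
by rewrite /dih_label mulgA dih_actM// dih_edge_step.
Qed.

Let alternating_labels i j w y (q : 'I_m) n : e i j ->
  dih_act m_gt1 i y = (false, q) -> (q + n <= m)%N ->
  [seq edge_label i w v | v <- word_path (w * y) (flatten (nseq n [:: i; j]))] =
  [seq (b, l) | l <- iota q n, b <- [:: true; false]].
Proof.
move=> eij; have ji : (j == i) = false.
  by apply/negbTE; apply: contraTneq eij => ->; rewrite e_irr.
elim: n y q => // n IH y q yq qn.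
have yi : dih_act m_gt1 i (y * s i) = (true, q).
  by rewrite dih_actM// yq /dih_step eqxx.
have yij : dih_act m_gt1 i (y * s i * s j) = (false, ordS q).
  by rewrite dih_actM// yi /dih_step ji.
(* The last round is separate: after it [ordS q] may wrap around to 0, whereas before it [ordS q] is
   q + 1. *)
have [n0|n_gt0] := posnP n.
  by rewrite n0 /= !edge_labelE /dih_label /dih_edge !eqxx ji -!mulgA !mulKg yq yi.
have Sq : ordS q = q.+1 :> nat.
  rewrite /= modn_small//; move: qn; rewrite addnS; apply: leq_trans.
  by rewrite ltnS -addn1 leq_add2l.
have := IH _ _ yij; rewrite Sq addSnnS => /(_ qn) IHq.
rewrite /= -!mulgA in IHq *; rewrite IHq !edge_labelE /dih_label /dih_edge eqxx ji.
by rewrite !mulKg yq yi.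
Qed.

(** The 2m edges are distinct because their labels run once through all pairs (b, l) with l < m. *)
Lemma winds_once_alternating w i j : e i j ->
  winds_once (pol w i j) (Vertex w) (word_path w (flatten (nseq m [:: i; j]))).
Proof.
move=> eij; split.
- have := edge_path_word_path w (flatten (nseq m [:: i; j])).
  by rewrite cox_gen_pow// mulg1.
- by move=> v; exact: face_alternating_path.
- apply: (@map_uniq _ _ (edge_label i w)); rewrite -[w in word_path w]mulg1.
  rewrite (alternating_labels w eij (dih_act1 e_irr m_gt1 i))//.
  by apply: allpairs_uniq => //; [exact: iota_uniq|move=> [? ?] [? ?] _ _ [-> ->]].
- by rewrite size_word_path size_flatten /shape map_nseq sumn_nseq.
Qed.

End AlternatingPaths.

(** * The connection of a system of local reflections *)

Section LocalReflections.
Variables (I : finType) (e : rel I) (m : nat).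
Hypotheses (e_sym : symmetric e) (e_irr : irreflexive e) (m_gt1 : (1 < m)%N).
Local Notation W := (coxeter e m).
Local Notation s := (@cox_gen I e m).
Local Notation cell := (cell e m).
Local Notation vtx := (vtx e_sym e_irr m_gt1).
Local Notation tau := (tau e_sym e_irr m_gt1).
Implicit Types (c d v : cell) (w : W) (i j k : I) (g : autX e m).

Variable sigma : cell -> cell -> cell.
Hypotheses (sigma_refl : local_reflection_system sigma)
  (sigma_flat : trivial_holonomy sigma).

Let sigma_star (z : W * I) : exists p : {perm I},
  (forall k, sigma (edg z.1 z.2) (edg z.1 k) = edg (z.1 * s z.2) (p k)) /\
  forall a b, e a b -> e (p a) (p b) /\
    sigma (edg z.1 z.2) (pol z.1 a b) = pol (z.1 * s z.2) (p a) (p b).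
Proof. by apply: (local_reflection_star e_sym e_irr m_gt1); exact: sigma_refl. Qed.

Lemma sigma_connection : exists con : W -> I -> {perm I},
  flat_connection con /\
  forall w i k, sigma (edg w i) (edg w k) = edg (w * s i) (con w i k).
Proof.
have [con' con'P] := choice sigma_star.
pose con w i := con' (w, i).
have conE w i k : sigma (edg w i) (edg w k) = edg (w * s i) (con w i k).
  exact: (con'P (w, i)).1.
have conP w i a b (eab : e a b) := (con'P (w, i)).2 a b eab.
have vw w i : ends (edg w i) (Vertex w) by rewrite ends_edg; left.
have sigma_facet w i c : adj (Vertex w) c -> adj (Vertex (w * s i)) c ->
    sigma (edg w i) c = c.
  move=> wc wsc; have [_ _ _] := sigma_refl (erefl : rank (edg w i) = 1%N).
  by apply; apply/vertices_facetP => x; rewrite ends_edg => -[->|->].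
have con_rev w i : con w i * con (w * s i) i = 1.
  apply/permP => k; rewrite permM perm1.
  apply: (edg_injr e_irr m_gt1 (w := w)).
  have := conE (w * s i) i (con w i k); rewrite edg_flip -conE cox_genK => <-.
  have [_ + _ _] := sigma_refl (erefl : rank (edg w i) = 1%N); apply.
  by apply: vertices_block_union (vw w i) _; exact: adj_vertex_edg.
have con_i w i : con w i i = i.
  apply: (edg_injr e_irr m_gt1 (w := w * s i)).
  rewrite -conE sigma_facet ?edg_flip//; first exact: adj_vertex_edg.
  by rewrite -edg_flip; exact: adj_vertex_edg.
(* The polygon of type {i, j} lies in the facet, so it is fixed and still contains the image of the
   edge of type j. That image has type i or j, and i is taken by the edge of type i. *)
have con_j w i j : e i j -> con w i j = j.
  move=> eij; have [ej] := conP w i i j eij; rewrite -/(con w i) con_i in ej *.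
  rewrite sigma_facet; last first.
  - by rewrite -pol_mull//; exact: adj_vertex_pol.
  - exact: adj_vertex_pol.
  rewrite -pol_mull// => pE.
  have : face (edg (w * s i) (con w i j)) (pol (w * s i) i j).
    by rewrite pE pol_sym//; apply: face_edg_pol; rewrite e_sym.
  case/(edg_in_pol e_irr m_gt1 eij) => //; rewrite -{2}(con_i w i) => /perm_inj ji.
  by rewrite ji e_irr in eij.
(* For the converse implication, reflect back with [con (w * s i) i]. *)
have con_adj w i j k : e (con w i j) (con w i k) = e j k.
  apply/idP/idP=> [ejk|/(conP w i j k)[]//].
  have [] := conP (w * s i) i _ _ ejk; rewrite -/(con _ _).
  by rewrite -!permM con_rev !perm1.
(* Composing reflections along a word path is iterating [con_step], with p as initial frame. *)
have holE w u (p : {perm I}) k :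
    holonomy sigma (word_path w u) (edg w (p k)) =
    edg (foldl (con_step con) (w, p) u).1 ((foldl (con_step con) (w, p) u).2 k).
  elim: u w p => [//|i u IH] w p.
  by rewrite /holonomy /= conE -permM; exact: IH.
have foldE w u p : (foldl (con_step con) (w, p) u).1 = w * cox_word e m u.
  elim: u w p => [|i u IH] w p; first by rewrite mulg1.
  by rewrite /= IH cox_word_cons mulgA.
exists con; split=> //; split=> // [w i j [->//|]|i j [w p] eij]; first exact: con_j.
rewrite -(foldl_alternate (con_step con)).
have m_gt0 : (0 < m)%N by exact: ltnW.
have := winds_once_alternating e_sym e_irr m_gt1 w eij.
(* [trivial_holonomy] takes the path with its first edge split off; this uses m > 0. *)
have : flatten (nseq m [:: i; j]) = i :: j :: flatten (nseq m.-1 [:: i; j]).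
  by rewrite -[in LHS](prednK m_gt0).
set u := flatten (nseq m _) => uE.
have fst_u : (foldl (con_step con) (w, p) u).1 = w.
  by rewrite foldE cox_gen_pow// mulg1.
move=> wind; have tri : triangle (Vertex w) (edg w i) (pol w i j).
  split=> //; first by rewrite rank_pol.
  apply/simplex3; split; [exact: adj_vertex_edg|exact: adj_vertex_pol|].
  exact: adj_edg_pol.
have hol k : holonomy sigma (word_path w u) (edg w (p k)) = edg w (p k).
  move: wind; rewrite uE => wind; apply: (sigma_flat tri wind).
  by apply/vertices_block; exact: adj_vertex_edg.
rewrite [LHS]surjective_pairing fst_u; congr pair.
apply/permP => k; apply: (edg_injr e_irr m_gt1 (w := w)).
by rewrite -(hol k) holE fst_u.
Qed.

(** Both sides give the type of one edge at the image of w s_i: reflect and then apply g on the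
    left, apply g and then reflect on the right. *)
Lemma preserves_connection (con : W -> I -> {perm I}) (Gamma : set (autX e m)) g :
  (forall w i k, sigma (edg w i) (edg w k) = edg (w * s i) (con w i k)) ->
  preserves Gamma sigma -> Gamma g -> forall w i,
  con w i * tau g (w * s i) = tau g w * con (vtx g w) (tau g w i).
Proof.
move=> conE pres Gg w i; apply/permP => k; rewrite !permM.
apply: (edg_injr e_irr m_gt1 (w := vtx g (w * s i))).
rewrite -aut_edg -conE.
have rgv : rank (g (edg w i)) = 1%N by rewrite aut_rank.
have := pres g Gg _ rgv (g (edg w k)); rewrite /pushforward /= !aut_funK => ->.
  by rewrite !aut_edg conE vtx_gen.
apply: (@vertices_block_union _ _ _ _ (g (Vertex w))).
  by rewrite aut_ends ends_edg; left.
by rewrite aut_adj; exact: adj_vertex_edg.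
Qed.

End LocalReflections.

(** * Commensurability *)

Section Commensurability.
Variables (I : finType) (e : rel I) (m : nat).
Hypotheses (e_sym : symmetric e) (e_irr : irreflexive e) (m_gt1 : (1 < m)%N).
Local Notation autX := (autX e m).
Local Notation Wgrp := (W_in_autX (e := e) (m := m)).
Local Notation tau := (tau e_sym e_irr m_gt1).
Implicit Types (g h k phi : autX) (Gamma N : set autX).

Lemma W_in_autX_free g h :
  Wgrp g -> Wgrp h -> g (Vertex 1) = h (Vertex 1) -> g = h.
Proof. by move=> [u _ <-] [w _ <-] []; rewrite !mulg1 => ->. Qed.

(* A finite index subgroup of a cocompact group has finitely many orbits, and
   W acts simply transitively on the vertices. *)
Lemma finite_index_W Gamma N phi : uniform_lattice Gamma ->
  subgroup N -> finite_index N Gamma -> conj_set phi N `<=` Wgrp ->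
  finite_index (conj_set phi N) Wgrp.
Proof.
move=> [[G1 GV] _ G_orb] sN [NG finN] NW.
pose x k : cell e m := phi^-1 (k^-1 (Vertex 1)).
pose orb (c : cell e m) := [set g c | g in Gamma].
have xV k : exists w, x k = Vertex w.
  case E : (x k) => [w||]; first by exists w.
    by move: (congr1 (@rank I e m) E); rewrite !aut_rank.
  by move: (congr1 (@rank I e m) E); rewrite !aut_rank.
(* One vertex is chosen in each Gamma-orbit, and [to k] carries [x k] to the chosen one. By [toP]
   the default of [to] is never reached. *)
pose base k : cell e m := Vertex (xget 1 [set w | orb (Vertex w) = orb (x k)]).
pose to k := xget 1 [set g | Gamma g /\ g (x k) = base k].
have toP k : Gamma (to k) /\ to k (x k) = base k.
  have base_orb : orb (x k) (base k).
    rewrite (_ : orb (x k) = orb (base k)); first by exists 1.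
    rewrite /base; case: xgetP => [//|none].
    by have [w xw] := xV k; case: (none w); rewrite /= xw.
  rewrite /to; case: xgetP => [g _ //|none].
  by case: base_orb => g Gg gx; case: (none g).
pose c k := (orb (x k), lcoset_set (to k) N).
apply: (@finite_index_separate _ _ c) => //.
- exact: conj_set_subgroup.
- apply: (sub_finite_set _ (finite_setX G_orb finN)) => _ [k _ <-]; split=> /=.
    by have [w ->] := xV k; exists w.
  by exists (to k) => //; exact: (toP k).1.
move=> k1 k2 Wk1 Wk2 [orb12 /(lcoset_set_eq _ _ sN) N12].
have base12 : base k1 = base k2 by rewrite /base orb12.
set n := (to k1)^-1 * to k2 in N12.
have nx : n (x k2) = x k1.
  by rewrite /n aut_mulE (toP k2).2 -base12 -(toP k1).2 aut_invE.
clearbody n.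
have sW := W_in_autX_subgroup e_sym e_irr m_gt1.
have Nn : conj_set phi N (phi * n * phi^-1) by exists n.
suff -> : k1^-1 * k2 = phi * n * phi^-1 by [].
(* Both sides now lie in W and send the vertex 1 to the same vertex, so freeness of W identifies
   them. *)
apply: (@mulIg _ k2^-1); rewrite mulgK.
apply: W_in_autX_free; first exact: subgroupV.
  by apply: subgroupM => //; [exact: NW|exact: subgroupV].
by rewrite !aut_mulE -/(x k2) nx /x aut_invE'.
Qed.

Lemma lattice_of_W_commensurable Gamma : uniform_lattice Gamma ->
  commensurable Gamma Wgrp ->
  exists Gamma', [/\ subgroup Gamma', finite_index Gamma' Gamma &
    exists sigma : cell e m -> cell e m -> cell e m,
      [/\ local_reflection_system sigma, preserves Gamma' sigma &
          trivial_holonomy sigma]].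
Proof.
move=> [sG _ _] [g [fin _]].
(* This is the intersection of Gamma with g^-1 W g, written as a conjugate so that finite index
   transfers directly. *)
pose Gamma' := conj_set g^-1 (conj_set g Gamma `&` Wgrp).
have Gamma'P h : Gamma' h -> Wgrp (g * h * g^-1).
  by move=> /conj_setP[_]; rewrite invgK.
exists Gamma'; split.
- apply: conj_set_subgroup; split=> [|a b [Ga Wa] [Gb Wb]].
    split; first exact: (conj_set_subgroup g sG).1.
    exact: (W_in_autX_subgroup e_sym e_irr m_gt1).1.
  split; first exact: (conj_set_subgroup g sG).2.
  exact: (W_in_autX_subgroup e_sym e_irr m_gt1).2.
- by rewrite -(conj_setK g Gamma); exact: finite_index_conj.
exists (refl_system g); split; first exact: refl_system_local.
- move=> h Gh; apply: (refl_system_preserves e_irr m_gt1) => /=; exact: Gamma'P.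
- exact: refl_system_trivial_holonomy.
Qed.

Lemma W_commensurable_of_reflections Gamma Gamma' sigma :
  uniform_lattice Gamma -> subgroup Gamma' -> finite_index Gamma' Gamma ->
  local_reflection_system sigma -> preserves Gamma' sigma ->
  trivial_holonomy sigma -> commensurable Gamma Wgrp.
Proof.
move=> G_lat sG' fin' sigma_refl pres flat.
have [con [con_flat conE]] := sigma_connection e_sym e_irr m_gt1 sigma_refl flat.
have [phi phi_con] := flat_connection_aut e_sym e_irr m_gt1 con_flat.
have tau_const g : Gamma' g ->
    forall w, tau (phi^-1 * g * phi) w = tau (phi^-1 * g * phi) 1.
  move=> Gg; apply: conj_tau_const phi_con _.
  exact: preserves_connection conE pres Gg.
have [sG _ _] := G_lat.
have sW := W_in_autX_subgroup e_sym e_irr m_gt1.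
(* The part of Gamma that phi^-1 conjugates into W. *)
pose N := [set g | Gamma g /\ Wgrp (phi^-1 * g * phi)].
have conjN : conj_set phi^-1 Gamma `&` Wgrp = conj_set phi^-1 N.
  have E k : phi^-1 * (phi^-1^-1 * k * phi^-1) * phi = k.
    by rewrite invgK -!mulgA mulKg mulVg mulg1.
  apply/seteqP; split=> k.
    by move=> [/conj_setP Gk Wk]; apply/conj_setP; split=> //; rewrite E.
  by move=> /conj_setP[Gk]; rewrite E => Wk; split=> //; apply/conj_setP.
have sN : subgroup N.
  split=> [|a b [Ga Wa] [Gb Wb]].
    by split; [exact: sG.1|rewrite mulg1 mulVg; exact: sW.1].
  split; first exact: sG.2.
  have -> : phi^-1 * (a * b^-1) * phi = phi^-1 * a * phi * (phi^-1 * b * phi)^-1.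
    by rewrite !invgM invgK -!mulgA mulVKg.
  exact: sW.2.
have finN : finite_index N Gamma.
  (* An element of Gamma' has, after conjugation, the same type permutation at all vertices. There
     are finitely many permutations of I, and two elements with the same one differ by an element of
     N. *)
  apply: (@finite_index_refine _ _ (fun g => tau (phi^-1 * g * phi) 1) Gamma') => //.
    by move=> g [].
  move=> a b Ga Gb ab; have [G'G _] := fin'.
  split; first by apply: subgroupM => //; [apply: subgroupV => //|]; exact: G'G.
  have := tau_const_quotient (tau_const a Ga) (tau_const b Gb) ab.
  by rewrite !invgM invgK -!mulgA mulVKg.
exists phi^-1; rewrite conjN; split; first exact: finite_index_conj.
by apply: finite_index_W G_lat sN finN _; rewrite -conjN => k [].
Qed.

End Commensurability.

Theorem theorem1p9 (I : finType) (e : rel I) (m : nat)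
  (e_sym : symmetric e) (e_irr : irreflexive e)
  (hm : (3 <= m)%N \/ m = 2%N /\ girth_ge e 4)
  (Gamma : set (autX e m)) (Gamma_lattice : uniform_lattice Gamma) :
  commensurable Gamma (W_in_autX (e := e) (m := m)) <->
  exists Gamma' : set (autX e m),
    [/\ subgroup Gamma', finite_index Gamma' Gamma &
      exists sigma : cell e m -> cell e m -> cell e m,
        [/\ local_reflection_system sigma, preserves Gamma' sigma &
            trivial_holonomy sigma]].
Proof.
have m_gt1 : (1 < m)%N by case: hm => [/ltnW //|[->]].
split; first exact: lattice_of_W_commensurable.
move=> [Gamma' [sG' fin' [sigma [sigma_refl pres flat]]]].
exact: W_commensurable_of_reflections Gamma_lattice sG' fin' sigma_refl pres flat.
Qed.
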